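(* Let $\xi,\xi_1,\xi_2,\dots$ be simple max-stable random vectors in $\mathbb{R}^d$ with spectral measures $\sigma,\sigma_1,\sigma_2,\dots$ on $\mathbb{S}$ and dependency sets $K,K_1,K_2,\dots$. The following are equivalent: (i) $\xi_n$ converges in distribution to $\xi$; (ii) $\sigma_n$ converges weakly to $\sigma$; (iii) $K_n$ converges to $K$ in the Hausdorff metric.
   Context: Fix a reference norm $\|\cdot\|$ on $\mathbb{R}^d$ and let $\mathbb{S}=\{x\in[0,\infty)^d:\|x\|=1\}$. A simple max-stable random vector is max-stable with unit Fréchet marginals, $\mathbb{P}\{\xi_i\le t\}=e^{-1/t}$ for $t>0$. Max-stable means that for each $n\ge2$ the coordinatewise maximum of $n$ i.i.d. copies equals $a_n\xi+b_n$ in distribution for some $a_n>0$, $b_n\in\mathbb{R}^d$. Every such $\xi$ satisfies $\mathbb{P}\{\xi\le x\}=\exp\{-\int_{\mathbb{S}}\max_i(a_i/x_i)\,\sigma(da)\}$ for $x\in(0,\infty)^d$, for a unique finite Borel measure $\sigma$ on $\mathbb{S}$ (the spectral measure) with $\int a_i\,\sigma(da)=1$ for all $i$. The dependency set of $\xi$ is the compact convex set $K$ with support function $h(K,x)=\sup_{y\in K}\langle y,x\rangle=\int_{\mathbb{S}}\max_i(a_ix_i)\,\sigma(da)$, $x\in[0,\infty)^d$. *)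

(* Defs.v *)
From HB Require Import structures.
From mathcomp Require Import all_boot all_order all_algebra.
From mathcomp Require Import all_classical all_reals all_analysis.
Set Implicit Arguments. Unset Strict Implicit. Unset Printing Implicit Defensive.
Import Order.TTheory GRing.Theory Num.Theory.
Import numFieldNormedType.Exports.
Local Open Scope classical_set_scope.
Local Open Scope ring_scope.

Definition Borel (R : realType) (d : nat) :=
  g_sigma_algebraType (@open 'rV[R]_d).

Definition is_norm (R : realType) (d : nat) (N : 'rV[R]_d -> R) : Prop :=
  [/\ forall x, N x = 0 -> x = 0,
      forall x y, N (x + y) <= N x + N y
    & forall (c : R) x, N (c *: x) = `|c| * N x].

Definition orthant (R : realType) (d : nat) : set 'rV[R]_d :=
  [set x | forall i, 0 <= x ord0 i].
Arguments orthant {R d}.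

Definition Ssph (R : realType) (d : nat) (N : 'rV[R]_d -> R) : set 'rV[R]_d :=
  [set x | orthant x /\ N x = 1].

Definition lbox (R : realType) (d : nat) (x : 'rV[R]_d) : set 'rV[R]_d :=
  [set y | forall i, y ord0 i <= x ord0 i].

Notation law R d := (probability (Borel R d) R).
Notation spmeasure R d := {measure set (Borel R d) -> \bar R}.

(** [mu] is the law of a simple max-stable random vector: unit Frechet
    marginals, and max-stability expressed on distribution functions
    (the coordinatewise maximum of n i.i.d. copies has distribution function
    F^n, and a xi + b <= x iff xi <= a^-1 (x - b)). *)
Definition simple_max_stable (R : realType) (d : nat) (mu : law R d) : Prop :=
  (forall (i : 'I_d) (t : R), 0 < t ->
     mu [set y : 'rV[R]_d | y ord0 i <= t] = (expR (- t^-1))%:E) /\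
  (forall n : nat, (2 <= n)%N ->
     exists (a : R) (b : 'rV[R]_d), 0 < a /\
       forall x : 'rV[R]_d,
         fine (mu (lbox x)) ^+ n = fine (mu (lbox (a^-1 *: (x - b))))).

Definition spectral_measure_of (R : realType) (d : nat) (N : 'rV[R]_d -> R)
    (mu : law R d) (sigma : spmeasure R d) : Prop :=
  [/\ sigma (~` Ssph N) = 0%E,
      (sigma setT < +oo)%E,
      forall i : 'I_d, (\int[sigma]_(a in Ssph N) (a ord0 i)%:E = 1)%E
    & forall x : 'rV[R]_d, (forall i, 0 < x ord0 i) ->
        mu (lbox x) =
        expeR (- \int[sigma]_(a in Ssph N)
                   (\big[Num.max/0]_(i < d) (a ord0 i / x ord0 i))%:E)%E].

Definition support_fun (R : realType) (d : nat) (K : set 'rV[R]_d)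
    (x : 'rV[R]_d) : \bar R :=
  ereal_sup [set (\sum_(i < d) y ord0 i * x ord0 i)%:E | y in K].

(** [K] is the dependency set associated with the spectral measure [sigma]:
    a compact convex set with h(K, x) = int_S max_i (a_i x_i) sigma(da) for
    x in [0,oo)^d.  To make "the" set K unique we use the standard convention
    that K is contained in [0,oo)^d and is lower-closed there. *)
Definition dependency_set_of (R : realType) (d : nat) (N : 'rV[R]_d -> R)
    (sigma : spmeasure R d) (K : set 'rV[R]_d) : Prop :=
  [/\ compact K,
      (forall y z (t : R), K y -> K z -> 0 <= t <= 1 ->
         K (t *: y + (1 - t) *: z)),
      K `<=` orthant,
      (forall y z, K y -> orthant z -> (forall i, z ord0 i <= y ord0 i) -> K z)
    & forall x, orthant x ->
        support_fun K x =
        (\int[sigma]_(a in Ssph N)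
           (\big[Num.max/0]_(i < d) (a ord0 i * x ord0 i))%:E)%E].

Definition cvg_in_distribution (R : realType) (d : nat)
    (mun : nat -> law R d) (mu : law R d) : Prop :=
  forall f : 'rV[R]_d -> R, continuous f ->
    (exists M : R, forall x, `|f x| <= M) ->
    (fun n => \int[mun n]_x (f x)%:E)%E @ \oo --> (\int[mu]_x (f x)%:E)%E.

(** weak convergence of finite measures on S: int_S f dsigma_n -> int_S f dsigma
    for every bounded continuous f : S -> R (functions on S are represented by
    functions on R^d whose restriction to S is continuous). *)
Definition weak_cvg_on (R : realType) (d : nat) (S : set 'rV[R]_d)
    (sigman : nat -> spmeasure R d) (sigma : spmeasure R d) : Prop :=
  forall f : 'rV[R]_d -> R, {within S, continuous f} ->
    (exists M : R, forall x, S x -> `|f x| <= M) ->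
    (fun n => \int[sigman n]_(a in S) (f a)%:E)%E @ \oo -->
      (\int[sigma]_(a in S) (f a)%:E)%E.

Definition pdist (R : realType) (d : nat) (N : 'rV[R]_d -> R)
    (a : 'rV[R]_d) (B : set 'rV[R]_d) : R :=
  inf [set N (a - b) | b in B].

Definition hausdorff_dist (R : realType) (d : nat) (N : 'rV[R]_d -> R)
    (A B : set 'rV[R]_d) : R :=
  Num.max (sup [set pdist N a B | a in A]) (sup [set pdist N b A | b in B]).

(* Main.v *)
(** Everything goes through [h_n(x) = int_S max_i (a_i x_i) sigma_n(da)], which is
    at once the support function of [K_n] and, through
    [P(xi_n <= x) = exp (- h_n(1/x))], minus the logarithm of the distribution
    function: each of (i), (ii), (iii) is equivalent to pointwise convergence of
    [h_n] on the open orthant.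
    - (i): a continuous cutoff between [1{y <= x}] and [1{y <= (1+e)x}] and the
      homogeneity of [h_n] recover [h_n(1/x)] up to a factor [1+e]; conversely, a
      bounded continuous function is uniformly close on a large box to a
      combination of indicators [1{y <= x}], and the unit Frechet marginals give
      tightness.
    - (ii): [max_i (a_i x_i)] is a continuous test function.  Conversely, for
      [V = 1{y <= x}] the integral of [V(a/u)] over [u] in ]0, |a|[ is
      [max_i (a_i max(1, 1/x_i)) - max_i (a_i/x_i)], whose [sigma_n]-integral is a
      difference of two values of [h_n].  Any continuous [f] on [S] is such an
      integral of a function on the orthant that is constant on each ray outside
      the unit cube, and the same approximation by combinations of lower box
      indicators applies.
    - (iii): Hausdorff-close sets have close support functions.  Conversely, the
      Euclidean projection [p] of [y] in [K_n] onto the lower-closed set [K] has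
      [x = y - p >= 0] and [|x|^2 <= h_n(x) - h(x)], and pointwise convergence of
      the equi-Lipschitz [h_n] is uniform on the unit cube. *)
Require Import Defs.
From HB Require Import structures.
From mathcomp Require Import all_boot all_order all_algebra.
From mathcomp Require Import all_classical all_reals all_analysis.
From mathcomp Require Import measurable_realfun lra ring.
Import Order.TTheory GRing.Theory Num.Theory.
Import numFieldNormedType.Exports.
Local Open Scope classical_set_scope.
Local Open Scope ring_scope.

(** * Row vectors and norms *)

Lemma within_continuous_epsP (R : realType) (d : nat) (A : set 'rV[R]_d)
    (f : 'rV[R]_d -> R) :
  {within A, continuous f} <-> forall x, A x -> forall e, 0 < e ->
    exists2 r, 0 < r & forall y, A y -> `|x - y| < r -> `|f x - f y| <= e.
Proof.
split.
  move=> /subspace_continuousP cf x Ax e e0.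
  have /cvgrPdist_le/(_ _ e0) := cf x Ax.
  rewrite near_withinE => /nbhs_ballP[r /= r0 H]; exists r => // y Ay xy.
  by apply: H => //; rewrite mx_norm_ball.
move=> H; apply/subspace_continuousP => x Ax; apply/cvgrPdist_le => e e0.
have [r r0 Hr] := H x Ax e e0.
rewrite near_withinE; apply/nbhs_ballP; exists r => // y; rewrite mx_norm_ball => xy Ay.
exact: Hr.
Qed.

Lemma continuous_epsP (R : realType) (d : nat) (f : 'rV[R]_d -> R) :
  continuous f <-> forall x, forall e, 0 < e ->
    exists2 r, 0 < r & forall y, `|x - y| < r -> `|f x - f y| <= e.
Proof.
rewrite continuous_subspace_setT.
split => [/within_continuous_epsP h x e e0|h]; last first.
  apply/within_continuous_epsP => x _ e e0.
  by have [r r0 Hr] := h x e e0; exists r => // y _; exact: Hr.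
by have [r r0 Hr] := h x I e e0; exists r => // y; exact: Hr.
Qed.

(** The initial value 0 of the maximum does not matter on the orthant, where every product is
    nonnegative; elsewhere it keeps [maxlin] nonnegative, so [maxlin a x <= 1] still says that each
    product is at most 1. *)
Definition maxlin (R : realType) (d : nat) (a x : 'rV[R]_d) : R :=
  \big[Num.max/0]_(i < d) (a ord0 i * x ord0 i).

Arguments maxlin {R d} a x.

Section Vectors.
Context {R : realType} {d : nat}.
Implicit Types a v x y : 'rV[R]_d.

Lemma coord_le_norm v i : `|v ord0 i| <= `|v|.
Proof.
rewrite [leRHS]/Num.norm /= mx_normrE.
exact: (le_bigmax _ (fun ij : 'I_1 * 'I_d => `|v ij.1 ij.2|) (ord0, i)).
Qed.

Lemma norm_le_coord v (c : R) :
  0 <= c -> (forall i, `|v ord0 i| <= c) -> `|v| <= c.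
Proof.
move=> c0 vc; rewrite [leLHS]/Num.norm /= mx_normrE; apply: bigmax_le => // -[j i] _.
by rewrite ord1 /= vc.
Qed.

Lemma maxlin_ge0 a x : 0 <= maxlin a x.
Proof. exact: bigmax_ge_id. Qed.

Lemma maxlin_ge a x i : a ord0 i * x ord0 i <= maxlin a x.
Proof. exact: (le_bigmax _ (fun i => a ord0 i * x ord0 i)). Qed.

Lemma maxlin_le a x (c : R) :
  0 <= c -> (forall i, a ord0 i * x ord0 i <= c) -> maxlin a x <= c.
Proof. by move=> c0 H; apply: bigmax_le. Qed.

Lemma maxlin_lip a b x y :
  `|maxlin a x - maxlin b y| <=
  \sum_(i < d) `|a ord0 i * x ord0 i - b ord0 i * y ord0 i|.
Proof.
have H a' b' x' y' : maxlin a' x' <= maxlin b' y' +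
    \sum_(i < d) `|a' ord0 i * x' ord0 i - b' ord0 i * y' ord0 i|.
  apply: maxlin_le => [|i]; first by rewrite addr_ge0 ?maxlin_ge0 ?sumr_ge0.
  have := maxlin_ge b' y' i.
  rewrite (bigD1 i) //=.
  have : 0 <= \sum_(j < d | j != i) `|a' ord0 j * x' ord0 j - b' ord0 j * y' ord0 j|.
    exact: sumr_ge0.
  have := ler_norm (a' ord0 i * x' ord0 i - b' ord0 i * y' ord0 i).
  by lra.
rewrite ler_norml; apply/andP; split.
  have := H b a y x.
  under eq_bigr do rewrite distrC.
  by lra.
by have := H a b x y; lra.
Qed.

Lemma maxlinZr (c : R) a x : 0 <= c -> maxlin a (c *: x) = c * maxlin a x.
Proof.
move=> c0; rewrite /maxlin big_endo ?mulr0 //; last by move=> u v; rewrite maxr_pMr.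
by apply: eq_bigr => i _; rewrite mxE; ring.
Qed.

Lemma maxlin_continuous x : continuous (fun a => maxlin a x).
Proof.
move=> a; rewrite /maxlin.
elim: (index_enum _) => [|i s IHs].
  rewrite (_ : (fun _ => _) = fun=> 0); first exact: (@cst_continuous _ R^o 0 a).
  by apply: funext => b; rewrite big_nil.
under eq_fun do rewrite big_cons.
apply: (@continuous_max R _ (fun a : 'rV[R]_d => a ord0 i * x ord0 i)
  (fun a => \big[Num.max/0]_(j <- s) (a ord0 j * x ord0 j))) => //.
by apply: continuousM; [exact: coord_continuous|exact: cst_continuous].
Qed.

End Vectors.

(** * Equivalence of the reference norm with the maximum norm *)

Section NormEquiv.
Context {R : realType} {d : nat} {N : 'rV[R]_d -> R}.
Context (normN : is_norm N).

Lemma norm_fun0 : N 0 = 0.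
Proof. by have [_ _ hZ] := normN; rewrite -(scale0r 0) hZ normr0 mul0r. Qed.

Lemma norm_funN v : N (- v) = N v.
Proof. by have [_ _ hZ] := normN; rewrite -scaleN1r hZ normrN1 mul1r. Qed.

Lemma norm_fun_ge0 v : 0 <= N v.
Proof.
have [_ hD hZ] := normN.
by have := hD v (- v); rewrite subrr norm_fun0 norm_funN; lra.
Qed.

Lemma norm_fun_upper : exists2 C : R, 0 < C & forall v, N v <= C * `|v|.
Proof.
have [_ hD hZ] := normN.
exists (1 + \sum_(i < d) N (delta_mx 0 i)).
  by rewrite ltr_wpDr ?sumr_ge0 // => i _; exact: norm_fun_ge0.
move=> v; rewrite {1}(row_sum_delta v).
have Nsum (s : seq 'I_d) (F : 'I_d -> 'rV[R]_d) :
    N (\sum_(i <- s) F i) <= \sum_(i <- s) N (F i).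
  elim: s => [|i s IH]; first by rewrite !big_nil norm_fun0.
  by rewrite !big_cons (le_trans (hD _ _)) // lerD2l.
apply: (le_trans (Nsum _ _)).
rewrite mulrDl mul1r ler_wpDl // mulr_suml; apply: ler_sum => i _.
rewrite hZ mulrC; apply: ler_wpM2l; [exact: norm_fun_ge0|exact: coord_le_norm].
Qed.

Lemma norm_fun_lip x y : `|N x - N y| <= N (x - y).
Proof.
have [_ hD hZ] := normN.
have := hD (x - y) y; have := hD (y - x) x; rewrite !subrK.
rewrite -(opprB x y) norm_funN ler_norml => h1 h2; apply/andP; split; lra.
Qed.

Lemma norm_fun_continuous : continuous N.
Proof.
have [C C0 HC] := norm_fun_upper.
apply/continuous_epsP => x e e0; exists (e / C); first exact: divr_gt0.
move=> y; rewrite ltr_pdivlMr // mulrC => /ltW xy.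
exact: le_trans (norm_fun_lip _ _) (le_trans (HC _) xy).
Qed.

(** The continuous function [N] attains a positive minimum on the compact unit sphere of the maximum
    norm; homogeneity does the rest. *)
Lemma norm_fun_lower : exists2 c : R, 0 < c & forall v, c * `|v| <= N v.
Proof.
have [h0 hD hZ] := normN.
pose A : set 'rV[R]_d := [set v | `|v| = 1].
have cA : compact A.
  apply: bounded_closed_compact.
    by exists 1; split => // M M1 v /= ->; exact: ltW.
  have -> : A = Num.norm @^-1` [set 1] by [].
  apply: closed_comp => [x _|]; first exact: norm_continuous.
  exact: closed_eq.
(* The sphere is empty exactly when [d = 0], and then 0 is the only vector. *)
have [[v0 Av0]|/set0P/negP/negPn/eqP A0] := pselect (A !=set0); last first.
  exists 1 => // v; have [->|v0] := eqVneq v 0.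
    by rewrite normr0 mulr0 norm_fun0.
  suff : A (`|v|^-1 *: v) by rewrite A0.
  by rewrite /A /= normrZ ger0_norm ?invr_ge0 // mulVf // normr_eq0.
have cN : {within A, continuous N}.
  exact/continuous_subspaceT/norm_fun_continuous.
have [c /set_mem Ac cmin] := EVT_min_rV (ex_intro _ _ Av0) cA cN.
exists (N c).
  rewrite lt_neqAle norm_fun_ge0 andbT eq_sym; apply/eqP => /h0 c0.
  by move: Ac; rewrite /A /= c0 normr0 => /esym/eqP; rewrite oner_eq0.
move=> v; have [->|v00] := eqVneq v 0; first by rewrite normr0 mulr0 norm_fun0.
have vp : 0 < `|v| by rewrite normr_gt0.
have : N c <= N (`|v|^-1 *: v).
  apply: cmin; rewrite inE /A /= normrZ ger0_norm ?invr_ge0 // mulVf //.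
  by rewrite normr_eq0.
by rewrite hZ ger0_norm ?invr_ge0 // mulrC ler_pdivlMr.
Qed.

Lemma orthant_closed : closed (@orthant R d).
Proof.
rewrite (_ : orthant = \bigcap_(i in setT) (fun v : 'rV[R]_d => v ord0 i) @^-1` [set t | 0 <= t]).
  apply: closed_bigI => i _; apply: closed_comp => [x _|]; last exact: closed_ge.
  exact: coord_continuous.
by apply/seteqP; split => [v h i _|v h i]; exact: h.
Qed.

Lemma Ssph_closed : closed (Ssph N).
Proof.
rewrite (_ : Ssph N = orthant `&` N @^-1` [set 1]) //.
apply: closedI; first exact: orthant_closed.
apply: closed_comp => [x _|]; [exact: norm_fun_continuous|exact: closed_eq].
Qed.

(** The lower bound controls the total mass of spectral measures and keeps rays away from the
    origin; the upper bound makes the integrands bounded. *)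
Lemma Ssph_norm_bounds : exists2 c : R, 0 < c &
  exists2 B : R, 0 < B & forall a, Ssph N a -> c <= `|a| <= B.
Proof.
have [C C0 HC] := norm_fun_upper; have [c c0 Hc] := norm_fun_lower.
exists C^-1; first by rewrite invr_gt0.
exists c^-1; first by rewrite invr_gt0.
move=> a [_ Na]; apply/andP; split.
  by rewrite -[X in X <= _]mul1r ler_pdivrMr // mulrC -Na.
by rewrite -[X in _ <= X]mul1r ler_pdivlMr // mulrC -Na.
Qed.

End NormEquiv.

Lemma lbox_closed (R : realType) (d : nat) (x : 'rV[R]_d) : closed (lbox x).
Proof.
rewrite (_ : lbox x = \bigcap_(i in setT) (fun v : 'rV[R]_d => v ord0 i) @^-1` [set t | t <= x ord0 i]).
  apply: closed_bigI => i _; apply: closed_comp => [y _|]; last exact: closed_le.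
  exact: coord_continuous.
by apply/seteqP; split => [v h i _|v h i]; exact: h.
Qed.

(** * Step functions adapted to lower boxes *)

(** Corners are strictly positive because the spectral formula gives the distribution function only
    at such points. The single linear rule [c * f + g] leaves one inductive case for every property
    preserved by linear combinations. *)
Inductive lbox_span {R : realType} {d : nat} : ('rV[R]_d -> R) -> Prop :=
| lbox_span_indic (x : 'rV[R]_d) :
    (forall i, 0 < x ord0 i) -> lbox_span \1_(lbox x)
| lbox_span_lin (c : R) (f g : 'rV[R]_d -> R) : lbox_span f -> lbox_span g ->
    lbox_span (fun y => c * f y + g y).

Definition pbox (R : realType) (d : nat) (M : R) : set 'rV[R]_d :=
  orthant `&` lbox (const_mx M).
Arguments pbox {R d}.

Section StepFunctions.
Context {R : realType} {d : nat}.
Implicit Types (f g : 'rV[R]_d -> R).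

Lemma lbox_span0 : lbox_span ((fun=> 0) : 'rV[R]_d -> R).
Proof.
have h : lbox_span (\1_(lbox (const_mx 1)) : 'rV[R]_d -> R).
  by apply: lbox_span_indic => i; rewrite mxE.
rewrite (_ : (fun=> 0) = fun y => -1 * \1_(lbox (const_mx 1)) y + \1_(lbox (const_mx 1)) y :> R).
  exact: lbox_span_lin.
by apply: funext => y; rewrite mulN1r addNr.
Qed.

Lemma lbox_spanZ c f : lbox_span f -> lbox_span (fun y => c * f y).
Proof.
move=> hf; rewrite (_ : (fun y => _) = fun y => c * f y + 0).
  by apply: lbox_span_lin => //; exact: lbox_span0.
by apply: funext => y; rewrite addr0.
Qed.

Lemma lbox_spanD f g :
  lbox_span f -> lbox_span g -> lbox_span (fun y => f y + g y).
Proof.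
move=> hf hg; rewrite (_ : (fun y => _) = fun y => 1 * f y + g y).
  exact: lbox_span_lin.
by apply: funext => y; rewrite mul1r.
Qed.

Lemma lbox_span_sum (I : Type) (s : seq I) (F : I -> 'rV[R]_d -> R) :
  (forall i, lbox_span (F i)) -> lbox_span (fun y => \sum_(i <- s) F i y).
Proof.
move=> hF; elim: s => [|i s IH].
  by under eq_fun do rewrite big_nil; exact: lbox_span0.
by under eq_fun do rewrite big_cons; exact: lbox_spanD.
Qed.

Lemma indic_lboxM (x z y : 'rV[R]_d) : \1_(lbox x) y * \1_(lbox z) y =
  \1_(lbox (\row_i Num.min (x ord0 i) (z ord0 i))) y :> R.
Proof.
rewrite -[LHS]/((\1_(lbox x) \* \1_(lbox z)) y) -indicI; congr (\1_ _ y).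
apply/seteqP; split => [v [hx hz] i|v h].
  by rewrite mxE le_min hx hz.
by split => i; have := h i; rewrite mxE le_min => /andP[].
Qed.

(** An intersection of lower boxes is a lower box, with the coordinatewise minimum as corner;
    bilinearity extends this to the span. *)
Lemma lbox_spanM f g :
  lbox_span f -> lbox_span g -> lbox_span (fun y => f y * g y).
Proof.
move=> hf hg; elim: hf => [x x0|c f1 f2 h1 IH1 h2 IH2]; last first.
  rewrite (_ : (fun y => _) = fun y => c * (f1 y * g y) + f2 y * g y).
    exact: lbox_span_lin.
  by apply: funext => y; rewrite mulrDl mulrA.
elim: hg => [z z0|c f1 f2 h1 IH1 h2 IH2]; last first.
  rewrite (_ : (fun y => _) = fun y => c * (\1_(lbox x) y * f1 y) + \1_(lbox x) y * f2 y).
    exact: lbox_span_lin.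
  by apply: funext => y; rewrite mulrDr mulrCA.
under eq_fun do rewrite indic_lboxM.
by apply: lbox_span_indic => i; rewrite mxE lt_min x0 z0.
Qed.

(** A half-space indicator is bounded in one coordinate only, so it enters the span after
    multiplication by a box indicator. That indicator is idempotent, so one copy can be given to
    each factor. *)
Lemma lbox_span_prod (x : 'rV[R]_d) (I : Type) (s : seq I)
    (F : I -> 'rV[R]_d -> R) : (forall i, 0 < x ord0 i) ->
  (forall i, lbox_span (fun y => \1_(lbox x) y * F i y)) ->
  lbox_span (fun y => \1_(lbox x) y * \prod_(i <- s) F i y).
Proof.
move=> x0 hF; elim: s => [|i s IH].
  under eq_fun do rewrite big_nil mulr1.
  exact: lbox_span_indic.
rewrite (_ : (fun y => _) = fun y => (\1_(lbox x) y * F i y) *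
    (\1_(lbox x) y * \prod_(j <- s) F j y)).
  exact: lbox_spanM.
apply: funext => y; rewrite big_cons !indicE.
by case: (y \in lbox x); rewrite ?mul1r ?mul0r.
Qed.

Lemma lbox_span_coord (x : 'rV[R]_d) (i : 'I_d) (t : R) :
  (forall j, 0 < x ord0 j) -> 0 < t ->
  lbox_span (fun y => \1_(lbox x) y * (y ord0 i <= t)%R%:R).
Proof.
move=> x0 t0.
pose z : 'rV[R]_d := \row_j if j == i then Num.min (x ord0 j) t else x ord0 j.
rewrite (_ : (fun y => _) = \1_(lbox z)).
  by apply: lbox_span_indic => j; rewrite mxE; case: ifP; rewrite ?lt_min ?x0.
apply: funext => y; rewrite !indicE -natrM mulnb; congr (_ %:R); congr nat_of_bool.
apply/idP/idP.
  move=> /andP[/set_mem yx yt]; apply/mem_set => j; rewrite mxE.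
  by case: eqP => [->|_]; rewrite ?le_min yx ?yt.
move=> /set_mem yz; apply/andP; split.
  apply/mem_set => j; have := yz j; rewrite mxE; case: eqP => // _.
  by rewrite le_min => /andP[].
by have := yz i; rewrite mxE eqxx le_min => /andP[].
Qed.

(** Heine-Cantor for a function continuous only relative to [A], through the near-covering form of
    compactness. *)
Lemma compact_within_unif (A : set 'rV[R]_d) f : compact A ->
  {within A, continuous f} -> forall e, 0 < e -> exists2 r, 0 < r &
    forall x y, A x -> A y -> `|x - y| < r -> `|f x - f y| <= e.
Proof.
move=> /compact_near_coveringP/near_covering_withinP cA.
move=> /within_continuous_epsP cf e e0.
have H : \forall r \near 0^'+, A `<=`
    [set x | forall y, A y -> `|x - y| < r -> `|f x - f y| <= e].
  apply: cA => x Ax.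
  have e2 : 0 < e / 2 by rewrite divr_gt0.
  have [r r0 Hr] := cf x Ax _ e2.
  have r2 : 0 < r / 2 by rewrite divr_gt0.
  exists (ball x (r / 2), [set s | 0 < s < r / 2]).
    split; first exact: nbhsx_ballx.
    exists (r / 2) => //= s; rewrite /ball_ /= sub0r normrN => h s0.
    by rewrite s0 /= (le_lt_trans _ h) // ler_norm.
  move=> [x' s] [/=]; rewrite mx_norm_ball => xx' /andP[s0 sr] Ax' y Ay x'y.
  have h1 : `|f x - f x'| <= e / 2.
    by apply: Hr => //; move: xx'; rewrite /ball_ /=; lra.
  have h2 : `|f x - f y| <= e / 2.
    apply: Hr => //; have := ler_distD x' x y; move: xx'; rewrite /ball_ /=.
    by move: x'y; lra.
  have := ler_distD (f x) (f x') (f y); rewrite (distrC (f x') (f x)).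
  by move: h1 h2; lra.
have [r /= r0 Hr] := H.
exists (r / 2); first by rewrite divr_gt0.
move=> x y Ax Ay xy; apply: (Hr (r / 2)) => //=.
  by rewrite /ball_ /= sub0r normrN gtr0_norm ?divr_gt0 //; lra.
by rewrite divr_gt0.
Qed.

Lemma pbox_compact (M : R) : compact (@pbox R d M).
Proof.
rewrite (_ : pbox M = 
    [set v : 'rV[R]_d | forall i, v ord0 i \in `[0, M]]).
  apply: (@rV_compact _ _ (fun=> `[0, M]%classic)) => _.
  exact: segment_compact.
apply/seteqP; split => [v [v0 vM] i|v vM].
  by rewrite /= in_itv /= v0; have := vM i; rewrite mxE.
by split => i; have := vM i; rewrite /= in_itv /= ?mxE => /andP[].
Qed.

(** Cut the cube into cells of side [h = M / m.+1], finer than the modulus of uniform continuity,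
    and let [V] take on each cell the value of [f] at the lowest corner. The bound [C] passes to [V]
    since its values on the cube are values of [f]. *)
Lemma lbox_span_approx (M C e : R) f : 0 < M -> 0 < e ->
  {within pbox M, continuous f} -> (forall y, pbox M y -> `|f y| <= C) ->
  exists V, [/\ lbox_span V,
    (forall y, pbox M y -> `|V y - f y| <= e),
    (forall y, pbox M y -> `|V y| <= C)
  & (forall y, ~ lbox (const_mx M) y -> V y = 0)].
Proof.
move=> M0 e0 cf fC.
have [r r0 fr] := compact_within_unif (pbox M) f (pbox_compact M) cf e e0.
have [m Mr] : exists m : nat, M / m.+1%:R < r.
  have h : 0 <= M / r by rewrite divr_ge0 ?ltW.
  have := archi_boundP h; set k := Num.Def.archi_bound _ => hk; exists k.
  rewrite ltr_pdivrMr ?ltr0n // mulrC -ltr_pdivrMr // (lt_trans hk) //.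
  by rewrite ltr_nat.
pose h := M / m.+1%:R.
have h0 : 0 < h by rewrite divr_gt0.
pose one : 'rV[R]_d -> R := \1_(lbox (const_mx M)).
(* Indicator of the interval from [k h] (excluded) to [(k+1) h] (included). For [k = 0] nothing is
   subtracted: the first interval then contains 0, and no box with a zero corner coordinate is
   needed. *)
pose chi (k : nat) (t : R) : R :=
  (t <= k.+1%:R * h)%R%:R - (0 < k)%N%:R * (t <= k%:R * h)%R%:R.
pose cell (k : {ffun 'I_d -> 'I_m.+1}) (y : 'rV[R]_d) := \prod_(i < d) chi (k i) (y ord0 i).
pose gp (k : {ffun 'I_d -> 'I_m.+1}) : 'rV[R]_d := \row_i ((k i)%:R * h).
have Mpos (i : 'I_d) : 0 < (const_mx M : 'rV[R]_d) ord0 i by rewrite mxE.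
exists (fun y => \sum_(k : {ffun 'I_d -> 'I_m.+1}) f (gp k) * (one y * cell k y)).
have grid y : pbox M y -> exists k : {ffun 'I_d -> 'I_m.+1},
    [/\ pbox M (gp k), `|gp k - y| < r &
     \sum_(k : {ffun 'I_d -> 'I_m.+1}) f (gp k) * (one y * cell k y) = f (gp k)].
  move=> [y0 yM].
  (* The cell of a coordinate is the least [k] with [y_i <= (k+1) h]; minimality makes all other
     [chi j] vanish there. *)
  have ex (i : 'I_d) : exists k : 'I_m.+1, k%:R * h <= y ord0 i <= k.+1%:R * h /\
      forall j : 'I_m.+1, chi j (y ord0 i) = (j == k)%:R.
    have yex : exists k : nat, y ord0 i <= k.+1%:R * h.
      exists m; rewrite /h mulrC divfK ?pnatr_eq0 //.
      by have := yM i; rewrite mxE.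
    case: (ex_minnP yex) => k yk kmin.
    have km : (k < m.+1)%N.
      rewrite ltnS; apply: kmin; rewrite /h mulrC divfK ?pnatr_eq0 //.
      by have := yM i; rewrite mxE.
    exists (Ordinal km) => /=; split.
      rewrite yk andbT; case: (posnP k) => [->|k0]; first by rewrite mul0r y0.
      rewrite leNgt; apply/negP => /ltW.
      by rewrite -{1}(prednK k0) => /kmin; rewrite leqNgt ltn_predL k0.
    move=> j; rewrite /chi -(inj_eq val_inj) /=.
    have mon (a b : nat) : (a <= b)%N -> a%:R * h <= b%:R * h.
      by move=> ab; rewrite ler_wpM2r ?ler_nat // ltW.
    case: (ltngtP (nat_of_ord j) k) => jk.
    - rewrite (_ : (y ord0 i <= j.+1%:R * h) = false); last first.
        by apply/negP => /kmin; rewrite leqNgt jk.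
      rewrite (_ : (y ord0 i <= j%:R * h) = false) ?mulr0 ?subr0 //.
      by apply/negP => /le_trans/(_ (mon _ _ (leqnSn j)))/kmin; rewrite leqNgt jk.
    - have -> : y ord0 i <= j.+1%:R * h by rewrite (le_trans yk) // mon // ltnS ltnW.
      have -> : y ord0 i <= j%:R * h by rewrite (le_trans yk) // mon.
      by rewrite (leq_ltn_trans _ jk) // mulr1 subrr.
    - rewrite jk yk; case: (posnP k) => [->|k0]; first by rewrite mul0r subr0.
      rewrite (_ : (y ord0 i <= k%:R * h) = false) ?mulr0 ?subr0 //.
      by apply/negP; rewrite -{1}(prednK k0) => /kmin; rewrite leqNgt ltn_predL k0.
  have [k hk] := choice ex.
  pose kf := [ffun i => k i]; exists kf; split.
  - split=> i; rewrite !mxE ?ffunE; first by rewrite mulr_ge0 // ltW.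
    have [/andP[kl _] _] := hk i; rewrite (le_trans kl) //.
    by have := yM i; rewrite mxE.
  - apply: le_lt_trans Mr; apply: norm_le_coord; first exact: ltW.
    move=> i; rewrite !mxE ffunE distrC ger0_norm ?subr_ge0; last first.
      by have [/andP[]] := hk i.
    by have [/andP[_ +] _] := hk i; rewrite -natr1 mulrDl mul1r lerBlDl.
  rewrite (bigD1 kf) //= big1 ?addr0; last first.
    move=> k' kk'; have [i ki] : exists i, k' i != k i.
      apply/existsP; rewrite -negb_forall; apply: contra kk' => /forallP H.
      by apply/eqP/ffunP => i; rewrite ffunE (eqP (H i)).
    rewrite /cell (bigD1 i) //= (proj2 (hk i)) (negbTE ki).
    by rewrite mul0r !mulr0.
  rewrite /one indicE mem_set // mul1r /cell big1 ?mulr1 // => i _.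
  by rewrite (proj2 (hk i)) ffunE eqxx.
split.
- apply: lbox_span_sum => k; apply: lbox_spanZ; apply: lbox_span_prod => // i.
  rewrite /chi; have [k0|k0] := posnP (k i).
    rewrite (_ : (fun y => _) = fun y => one y * (y ord0 i <= (k i).+1%:R * h)%R%:R).
      by apply: lbox_span_coord => //; rewrite mulr_gt0.
    by apply: funext => y; rewrite k0 mul0r subr0.
  rewrite (_ : (fun y => _) = fun y => -1 * (one y * (y ord0 i <= (k i)%:R * h)%R%:R)
      + one y * (y ord0 i <= (k i).+1%:R * h)%R%:R).
    by apply: lbox_span_lin; apply: lbox_span_coord => //; rewrite mulr_gt0 // ltr0n.
  by apply: funext => y; rewrite mul1r mulrBr mulN1r addrC.
- by move=> y yM; have [k [kM ky ->]] := grid y yM; exact: fr.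
- by move=> y yM; have [k [kM ky ->]] := grid y yM; exact: fC.
- move=> y yM; apply: big1 => k _; rewrite /one indicE memNset //.
  by rewrite mul0r mulr0.
Qed.

End StepFunctions.

(** * Integrals of bounded functions *)

Section BoundedMeasurable.
Context {disp : measure_display} {T : measurableType disp} {R : realType}.
Implicit Types (D : set T) (f g : T -> R) (m : {measure set T -> \bar R}).

Definition bounded_measurable D f : Prop :=
  measurable_fun D f /\ exists M : R, forall x, D x -> `|f x| <= M.

Lemma bounded_measurable_lin D (c : R) f g :
  bounded_measurable D f -> bounded_measurable D g ->
  bounded_measurable D (fun x => c * f x + g x).
Proof.
move=> [mf [M hM]] [mg [M' hM']]; split.
  by apply: measurable_funD => //; apply: measurable_funM => //; exact: measurable_cst.
exists (`|c| * M + M') => x Dx.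
rewrite (le_trans (ler_normD _ _)) // lerD ?hM' // normrM.
by rewrite ler_wpM2l ?hM.
Qed.

Lemma bounded_measurable_integrable D m f : measurable D -> (m D < +oo)%E ->
  bounded_measurable D f -> m.-integrable D (EFin \o f).
Proof.
move=> mD fin [mf [M hM]]; apply: measurable_bounded_integrable => //.
exists M; split; first exact: num_real.
by move=> M' MM' x Dx /=; rewrite (le_trans (hM _ Dx)) // ltW.
Qed.

Lemma bounded_measurable_EFin D m f : measurable D -> (m D < +oo)%E ->
  bounded_measurable D f ->
  (\int[m]_(x in D) (f x)%:E)%E = (\int[m]_(x in D) f x)%:E.
Proof.
move=> mD fin bf; rewrite /Rintegral fineK //; apply: integrable_fin_num => //.
exact: bounded_measurable_integrable.
Qed.

Lemma Rintegral_lin D m (c : R) f g : measurable D -> (m D < +oo)%E ->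
  bounded_measurable D f -> bounded_measurable D g ->
  \int[m]_(x in D) (c * f x + g x) =
  c * \int[m]_(x in D) f x + \int[m]_(x in D) g x.
Proof.
move=> mD fin bf bg; have intf h := bounded_measurable_integrable D m h mD fin.
rewrite RintegralD //; first by rewrite RintegralZl //; exact: intf.
  have -> : EFin \o (fun x => c * f x) = EFin \o (fun x => c * f x + (fun=> 0) x).
    by apply: funext => x /=; rewrite addr0.
  apply: intf; apply: bounded_measurable_lin => //.
  split; first exact: measurable_cst.
  by exists 0 => x _; rewrite normr0.
exact: intf.
Qed.

(** The majorant may vary from point to point, so that a large error is allowed on a set of small
    measure. *)
Lemma Rintegral_dist_le_fun D m f g h : measurable D -> (m D < +oo)%E ->
  bounded_measurable D f -> bounded_measurable D g -> bounded_measurable D h ->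
  (forall x, D x -> `|f x - g x| <= h x) ->
  `|\int[m]_(x in D) f x - \int[m]_(x in D) g x| <= \int[m]_(x in D) h x.
Proof.
move=> mD fin bf bg bh H; have intf k := bounded_measurable_integrable D m k mD fin.
have key h1 h2 : bounded_measurable D h1 -> bounded_measurable D h2 ->
    (forall x, D x -> h1 x <= h x + h2 x) ->
    \int[m]_(x in D) h1 x <= \int[m]_(x in D) h x + \int[m]_(x in D) h2 x.
  move=> b1 b2 h12; rewrite -RintegralD //; try exact: intf.
  apply: le_Rintegral => //; try exact: intf.
  apply: intf.
  have := bounded_measurable_lin D 1 _ _ bh b2.
  by under eq_fun do rewrite mul1r.
have h1 : \int[m]_(x in D) g x <= \int[m]_(x in D) h x + \int[m]_(x in D) f x.
  by apply: key => // x Dx; have := H x Dx; rewrite ler_norml => /andP[]; lra.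
have h2 : \int[m]_(x in D) f x <= \int[m]_(x in D) h x + \int[m]_(x in D) g x.
  by apply: key => // x Dx; have := H x Dx; rewrite ler_norml => /andP[]; lra.
by rewrite ler_norml; apply/andP; split; lra.
Qed.

Lemma Rintegral_dist_le D m (e : R) f g : measurable D -> (m D < +oo)%E ->
  bounded_measurable D f -> bounded_measurable D g ->
  (forall x, D x -> `|f x - g x| <= e) ->
  `|\int[m]_(x in D) f x - \int[m]_(x in D) g x| <= e * fine (m D).
Proof.
move=> mD fin bf bg H; rewrite -Rintegral_cst //.
apply: Rintegral_dist_le_fun => //.
by split; [exact: measurable_cst|exists `|e|].
Qed.

Lemma cvg_integral_RintegralP D f (mn : nat -> {measure set T -> \bar R}) m :
  measurable D -> (m D < +oo)%E -> (forall n, (mn n D < +oo)%E) ->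
  bounded_measurable D f ->
  ((fun n => \int[mn n]_(x in D) (f x)%:E)%E @ \oo -->
    (\int[m]_(x in D) (f x)%:E)%E) <->
  ((fun n => \int[mn n]_(x in D) f x) @ \oo --> \int[m]_(x in D) f x).
Proof.
move=> mD fin finn bf.
rewrite bounded_measurable_EFin //.
under eq_fun do rewrite bounded_measurable_EFin //.
split; first exact: fine_cvg.
by move=> h; apply: cvg_EFin => //; exact: nearW.
Qed.

End BoundedMeasurable.

(** An [e / 3] argument. It is used to pass from test functions with known limits to general ones,
    the error being uniform in [n]. *)
Lemma cvg_uniform_approx (R : realType) (u : nat -> R) (l : R) :
  (forall e : R, 0 < e -> exists v : nat -> R, exists2 l' : R, v @ \oo --> l' &
    (forall n, `|u n - v n| <= e) /\ `|l - l'| <= e) ->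
  u @ \oo --> l.
Proof.
move=> H; apply/cvgrPdist_le => e e0.
have e3 : 0 < e / 3 by rewrite divr_gt0.
have [v [l' /cvgrPdist_le/(_ _ e3) vl [uv ll']]] := H _ e3.
apply: filterS vl => n vn; have := uv n.
have := ler_distD l' l (u n); have := ler_distD (v n) l' (u n).
rewrite (distrC (v n)); lra.
Qed.

(** * Borel measurability of closed sets and continuous functions *)

Section BorelVectors.
Context {R : realType} {d : nat}.

Lemma closed_Borel_measurable (A : set 'rV[R]_d) :
  closed A -> measurable (A : set (Borel R d)).
Proof.
move=> cA; rewrite -(setCK A); apply: measurableC; apply: sub_sigma_algebra.
exact: closed_openC.
Qed.

Lemma within_continuous_measurable (D : set 'rV[R]_d) (f : 'rV[R]_d -> R) :
  closed D -> {within D, continuous f} ->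
  measurable_fun (D : set (Borel R d)) (f : Borel R d -> R).
Proof.
move=> cD /continuousP cf; apply: (measurability _ (RGenOpens.measurableE R)).
move=> _ [_ [a [b ->] <-]].
have oab : open (`]a, b[%classic : set R) by exact: interval_open.
have /open_subspaceP[V oV VE] := cf _ oab.
rewrite setIC -VE; apply: measurableI.
  exact: sub_sigma_algebra.
exact: closed_Borel_measurable.
Qed.

End BorelVectors.

(** * The tail dependence function *)

Definition hfun (R : realType) (d : nat) (N : 'rV[R]_d -> R)
    (m : spmeasure R d) (x : 'rV[R]_d) : R :=
  \int[m]_(a in Ssph N) maxlin a x.
Arguments hfun {R d} N m x.

(** The properties of a spectral measure that do not mention the law; they suffice for estimates
    uniform over all spectral measures. *)
Definition normalized (R : realType) (d : nat) (N : 'rV[R]_d -> R)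
    (m : spmeasure R d) : Prop :=
  (m setT < +oo)%E /\
  forall i : 'I_d, (\int[m]_(a in Ssph N) (a ord0 i)%:E = 1)%E.
Arguments normalized {R d} N m.

Definition inv_row (R : realType) (d : nat) (x : 'rV[R]_d) : 'rV[R]_d :=
  \row_i (x ord0 i)^-1.
Arguments inv_row {R d} x.

Section Sphere.
Context {R : realType} {d : nat} {N : 'rV[R]_d -> R}.
Context (normN : is_norm N).
Local Notation S := (Ssph N : set (Borel R d)).

Lemma measurable_Ssph : measurable S.
Proof. by apply: closed_Borel_measurable; exact: Ssph_closed. Qed.

Lemma continuous_bounded_measurable (f : 'rV[R]_d -> R) (M : R) :
  {within Ssph N, continuous f} -> (forall a, Ssph N a -> `|f a| <= M) ->
  bounded_measurable S f.
Proof.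
move=> cf fM; split; last by exists M.
by apply: within_continuous_measurable => //; exact: Ssph_closed.
Qed.

Lemma maxlin_bounded_measurable x :
  bounded_measurable S (fun a => maxlin a x).
Proof.
have [c _ [B B0 HB]] := Ssph_norm_bounds normN.
apply: (continuous_bounded_measurable _ (B * `|x|)).
  exact/continuous_subspaceT/maxlin_continuous.
move=> a /HB /andP[_ aB]; rewrite ger0_norm ?maxlin_ge0 //.
apply: maxlin_le => [|i]; first by rewrite mulr_ge0 // ltW.
rewrite (le_trans (ler_norm _)) // normrM ler_pM //.
  exact: le_trans (coord_le_norm _ _) aB.
exact: coord_le_norm.
Qed.

Lemma coord_bounded_measurable i :
  bounded_measurable S (fun a : 'rV[R]_d => a ord0 i).
Proof.
have [c _ [B B0 HB]] := Ssph_norm_bounds normN.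
apply: (continuous_bounded_measurable _ B).
  exact/continuous_subspaceT/coord_continuous.
by move=> a /HB /andP[_ aB]; exact: le_trans (coord_le_norm _ _) aB.
Qed.

Lemma cst_bounded_measurable (c : R) : bounded_measurable S (fun=> c).
Proof. by split; [exact: measurable_cst|exists `|c|]. Qed.

Lemma lin_bounded_measurable (c : 'I_d -> R) (s : seq 'I_d) :
  bounded_measurable S (fun a : 'rV[R]_d => \sum_(i <- s) c i * a ord0 i).
Proof.
elim: s => [|i s IH].
  by under eq_fun do rewrite big_nil; exact: cst_bounded_measurable.
under eq_fun do rewrite big_cons.
by apply: bounded_measurable_lin => //; exact: coord_bounded_measurable.
Qed.

Section Normalized.
Context {m : spmeasure R d}.
Context (nm : normalized N m).

Lemma Ssph_mass_fin : (m S < +oo)%E.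
Proof.
have [h _] := nm; apply: le_lt_trans h; apply: le_measure; rewrite ?inE //.
exact: measurable_Ssph.
Qed.

Lemma Rintegral_coord i : \int[m]_(a in S) (a : 'rV[R]_d) ord0 i = 1.
Proof. by have [_ h] := nm; rewrite /Rintegral h. Qed.

(** Since each coordinate integrates to 1, bounding an integrand by a linear form gives a bound
    independent of the measure. *)
Lemma Rintegral_lin_coord (c : 'I_d -> R) (s : seq 'I_d) :
  \int[m]_(a in S) (\sum_(i <- s) c i * (a : 'rV[R]_d) ord0 i) = \sum_(i <- s) c i.
Proof.
elim: s => [|i s IH].
  under eq_Rintegral do rewrite big_nil.
  by rewrite Rintegral_cst ?mul0r ?big_nil //; exact: measurable_Ssph.
under eq_Rintegral do rewrite big_cons.
rewrite Rintegral_lin ?IH ?Rintegral_coord ?mulr1 ?big_cons //.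
- exact: measurable_Ssph.
- exact: Ssph_mass_fin.
- exact: coord_bounded_measurable.
- exact: lin_bounded_measurable.
Qed.

Lemma Ssph_bounded_integrable f : bounded_measurable S f -> m.-integrable S (EFin \o f).
Proof.
by apply: bounded_measurable_integrable; [exact: measurable_Ssph|exact: Ssph_mass_fin].
Qed.

(** On the sphere the integrands differ by at most the linear form with coefficients [|x_i - y_i|].
    The resulting Lipschitz constant does not depend on [m], which makes the [h_n]
    equicontinuous. *)
Lemma hfun_lip (x y : 'rV[R]_d) : `|hfun N m x - hfun N m y| <= \sum_(i < d) `|x ord0 i - y ord0 i|.
Proof.
have H (x' y' : 'rV[R]_d) : hfun N m x' <= \sum_(i < d) `|x' ord0 i - y' ord0 i| + hfun N m y'.
  rewrite -(Rintegral_lin_coord (fun i => `|x' ord0 i - y' ord0 i|)) /hfun.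
  rewrite -RintegralD; first last.
  - exact/Ssph_bounded_integrable/maxlin_bounded_measurable.
  - exact/Ssph_bounded_integrable/lin_bounded_measurable.
  - exact: measurable_Ssph.
  apply: le_Rintegral.
  - exact: measurable_Ssph.
  - exact/Ssph_bounded_integrable/maxlin_bounded_measurable.
  - apply: Ssph_bounded_integrable.
    have := bounded_measurable_lin S 1 _ _
      (lin_bounded_measurable (fun i => `|x' ord0 i - y' ord0 i|) (index_enum _))
      (maxlin_bounded_measurable y').
    by under eq_fun do rewrite mul1r.
  - move=> a [a0 _]; have := ler_norm (maxlin a x' - maxlin a y').
    have := maxlin_lip a a x' y'.
    under eq_bigr => i _ do rewrite -mulrBr normrM (ger0_norm (a0 i)) mulrC.
    by lra.
rewrite ler_norml; apply/andP; split.
  by have := H y x; under eq_bigr do rewrite distrC; lra.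
by have := H x y; lra.
Qed.

Lemma hfunZ (c : R) x : 0 <= c -> hfun N m (c *: x) = c * hfun N m x.
Proof.
move=> c0; rewrite /hfun -RintegralZl; first last.
- exact/Ssph_bounded_integrable/maxlin_bounded_measurable.
- exact: measurable_Ssph.
by apply: eq_Rintegral => a _; rewrite maxlinZr.
Qed.

Lemma hfun_ge0 x : 0 <= hfun N m x.
Proof. by apply: Rintegral_ge0 => a _; exact: maxlin_ge0. Qed.

Lemma hfun_le (x : 'rV[R]_d) : hfun N m x <= \sum_(i < d) `|x ord0 i|.
Proof.
have := hfun_lip x 0; under eq_bigr do rewrite mxE subr0.
have -> : hfun N m 0 = 0 by rewrite -(scale0r (0 : 'rV[R]_d)) hfunZ // mul0r.
by rewrite subr0 ger0_norm ?hfun_ge0.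
Qed.

Lemma integral_maxlin x :
  (\int[m]_(a in S) (maxlin a x)%:E = (hfun N m x)%:E)%E.
Proof.
apply: bounded_measurable_EFin.
- exact: measurable_Ssph.
- exact: Ssph_mass_fin.
- exact: maxlin_bounded_measurable.
Qed.

End Normalized.

(** Integrate [c <= |a| <= a_1 + ... + a_d] over the sphere: [c] times the mass is at most [d]. *)
Lemma Ssph_mass_bound : exists C : R, forall m : spmeasure R d,
  normalized N m -> fine (m S) <= C.
Proof.
have [c c0 [B B0 HB]] := Ssph_norm_bounds normN.
exists (d%:R / c) => m nm; rewrite ler_pdivlMr // mulrC.
have mS := measurable_Ssph.
rewrite -(Rintegral_cst m mS c).
have -> : d%:R = \sum_(i < d) 1 :> R by rewrite sumr_const card_ord.
rewrite -(Rintegral_lin_coord nm); apply: le_Rintegral => //.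
- exact/(Ssph_bounded_integrable nm)/cst_bounded_measurable.
- exact/(Ssph_bounded_integrable nm)/lin_bounded_measurable.
- move=> a Sa; have /andP[ca _] := HB a Sa; have [a0 _] := Sa.
  rewrite (le_trans ca) //; apply: norm_le_coord => [|i].
    by apply: sumr_ge0 => i _; rewrite mul1r.
  rewrite ger0_norm // (bigD1 i) //= mul1r lerDl.
  by apply: sumr_ge0 => j _; rewrite mul1r.
Qed.

Lemma spectral_normalized (mu : law R d) (m : spmeasure R d) :
  spectral_measure_of N mu m -> normalized N m.
Proof. by case. Qed.

Lemma spectral_cdf (mu : law R d) (m : spmeasure R d) (x : 'rV[R]_d) :
  spectral_measure_of N mu m -> (forall i, 0 < x ord0 i) ->
  mu (lbox x) = (expR (- hfun N m (inv_row x)))%:E.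
Proof.
move=> sm x0; have nm := spectral_normalized _ _ sm; have [_ _ _ h] := sm.
rewrite h // -[RHS]/(expeR (- (hfun N m (inv_row x))%:E)) -integral_maxlin //.
congr (expeR (- _)); apply: eq_integral => a _; congr (_%:E).
by apply: eq_bigr => i _; rewrite mxE.
Qed.

End Sphere.

(** * Convergence in distribution *)

Section Distribution.
Context {R : realType} {d : nat} {N : 'rV[R]_d -> R}.
Context (normN : is_norm N).

Lemma expRNV_le (t : R) : 0 < t -> expR (- t^-1) <= t.
Proof.
move=> t0; rewrite expRN -[leRHS]invrK lef_pV2 ?posrE ?expR_gt0 ?invr_gt0 //.
by have := expR_ge1Dx t^-1; lra.
Qed.

(** The Frechet marginals give each half-space [y_i <= 0] mass at most [exp (- 1 / e) <= e] for
    every [e > 0]. *)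
Lemma simple_orthant_null (nu : law R d) : simple_max_stable nu ->
  nu (~` orthant) = 0%E.
Proof.
move=> [marg _].
have mO : measurable (~` orthant : set (Borel R d)).
  by apply: measurableC; apply: closed_Borel_measurable; exact: orthant_closed.
have mi (i : 'I_d) (t : R) :
    measurable ([set y : 'rV[R]_d | y ord0 i <= t] : set (Borel R d)).
  apply: closed_Borel_measurable.
  apply: (@closed_comp _ _ (fun y : 'rV[R]_d => y ord0 i) [set s | s <= t]).
    by move=> y _; exact: coord_continuous.
  exact: closed_le.
have nul (i : 'I_d) : nu [set y : 'rV[R]_d | y ord0 i <= 0] = 0%E.
  apply/eqP; rewrite eq_le measure_ge0 andbT.
  apply/lee_addgt0Pr => e e0; rewrite add0e.
  apply: (@le_trans _ _ (nu [set y : 'rV[R]_d | y ord0 i <= e])).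
    have m0 := mi i 0; have me := mi i e; apply: le_measure; rewrite ?inE //.
    by move=> y /= /le_trans; apply; exact: ltW.
  by rewrite marg // lee_fin expRNV_le.
apply/negligibleP => //.
(* The finitely many half-spaces are indexed by all naturals, with empty sets from [d] on, to use
   countable subadditivity. *)
pose F (k : nat) : set (Borel R d) :=
  [set y : 'rV[R]_d | exists2 i : 'I_d, i = k :> nat & y ord0 i <= 0].
apply: (@negligibleS _ _ _ nu (\bigcup_k F k)).
  move=> y /existsNP[i /negP]; rewrite -ltNge => yi.
  by exists i => //; exists i => //; exact: ltW.
apply: negligible_bigcup => k.
have [kd|kd] := ltnP k d; last first.
  rewrite (_ : F k = set0); first exact: negligible_set0.
  by apply/seteqP; split=> // y [i ik _]; move: kd; rewrite -ik leqNgt ltn_ord.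
apply: (@negligibleS _ _ _ nu [set y : 'rV[R]_d | y ord0 (Ordinal kd) <= 0]).
  by move=> y [i ik yi] /=; rewrite (_ : Ordinal kd = i) //; exact/val_inj.
exact/(negligibleP nu (mi _ 0))/nul.
Qed.

Lemma measurable_lbox (x : 'rV[R]_d) : measurable (lbox x : set (Borel R d)).
Proof. by apply: closed_Borel_measurable; exact: lbox_closed. Qed.

Lemma law_fin (nu : law R d) (A : set (Borel R d)) :
  measurable A -> (nu A < +oo)%E.
Proof. by move=> mA; rewrite (le_lt_trans (probability_le1 _ mA)) ?ltry. Qed.

Lemma indic_bounded_measurable (D A : set (Borel R d)) : measurable A ->
  bounded_measurable D (\1_A : Borel R d -> R).
Proof.
move=> mA; split; first exact: measurable_indic.
by exists 1 => x _; rewrite indicE normr_nat; case: (_ \in _).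
Qed.

Lemma Rintegral_indic (nu : law R d) (A : set (Borel R d)) : measurable A ->
  \int[nu]_x (\1_A x : R) = fine (nu A).
Proof. by move=> mA; rewrite /Rintegral integral_indic ?setIT. Qed.

Lemma lbox_span_bounded_measurable (D : set (Borel R d)) (V : 'rV[R]_d -> R) :
  lbox_span V -> bounded_measurable D V.
Proof.
elim => [x _|c f g _ hf _ hg]; last exact: bounded_measurable_lin.
by apply: indic_bounded_measurable; exact: measurable_lbox.
Qed.

Lemma bounded_continuous_bounded_measurable (f : 'rV[R]_d -> R) (M : R) :
  continuous f -> (forall x, `|f x| <= M) ->
  bounded_measurable (setT : set (Borel R d)) f.
Proof.
move=> cf fM; split; last by exists M.
apply: within_continuous_measurable; first exact: closedT.
exact/continuous_subspaceT.
Qed.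

(** By [1 - exp (- h) <= h] and [h (1/M, ..., 1/M) <= d / M]. The bound does not depend on the law:
    this is the tightness. *)
Lemma law_tail (nu : law R d) (m : spmeasure R d) (M : R) : 0 < M ->
  spectral_measure_of N nu m -> fine (nu (~` lbox (const_mx M))) <= d%:R / M.
Proof.
move=> M0 sm; have nm := spectral_normalized _ _ sm.
rewrite probability_setC; last exact: measurable_lbox.
rewrite (spectral_cdf normN _ _ _ sm) => [|i]; last by rewrite mxE.
rewrite /=.
have := hfun_le normN nm (inv_row (const_mx M)).
under eq_bigr do rewrite !mxE ger0_norm ?invr_ge0 ?ltW //.
rewrite sumr_const card_ord -[M^-1 *+ d]mulr_natl.
by have := expR_ge1Dx (- hfun N m (inv_row (const_mx M))); lra.
Qed.

Lemma law_Rintegral_approx (nu : law R d) (m : spmeasure R d)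
    (f V : 'rV[R]_d -> R) (C M e : R) :
  simple_max_stable nu -> spectral_measure_of N nu m -> 0 < M -> 0 <= e ->
  continuous f -> (forall x, `|f x| <= C) -> lbox_span V ->
  (forall y, pbox M y -> `|V y - f y| <= e) ->
  (forall y, ~ lbox (const_mx M) y -> V y = 0) ->
  `|\int[nu]_x f x - \int[nu]_x V x| <= e + C * (d%:R / M).
Proof.
move=> snu sm M0 e0 cf fC sV Vf V0.
have C0 : 0 <= C by rewrite (le_trans _ (fC 0)).
have [_ [K VK]] := lbox_span_bounded_measurable setT V sV.
have bf := bounded_continuous_bounded_measurable f C cf fC.
pose A1 : set (Borel R d) := ~` lbox (const_mx M).
pose A2 : set (Borel R d) := ~` orthant.
have mA1 : measurable A1 by apply: measurableC; exact: measurable_lbox.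
have mA2 : measurable A2.
  by apply: measurableC; apply: closed_Borel_measurable; exact: orthant_closed.
have finT : (nu setT < +oo)%E by apply: law_fin.
have bc : bounded_measurable (setT : set (Borel R d)) (fun=> e).
  by split; [exact: measurable_cst|exists `|e|].
have b1 := indic_bounded_measurable setT A1 mA1.
have b2 := indic_bounded_measurable setT A2 mA2.
have b2c := bounded_measurable_lin _ (C + K) _ _ b2 bc.
have b12c := bounded_measurable_lin _ C _ _ b1 b2c.
(* The majorant is [e] everywhere, plus [C] off the lower box, where [V] vanishes, plus [C + K] off
   the orthant, with [K] a bound for [V]. The last set is null, so [K] leaves the final estimate. *)
apply: (le_trans (Rintegral_dist_le_fun _ _ _ _ _ measurableT finT bf
  (lbox_span_bounded_measurable setT V sV) b12c _)) => [x _|].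
  have K0 : 0 <= K by rewrite (le_trans _ (VK x I)).
  rewrite !indicE.
  have [xO|xO] := pselect (orthant x); last first.
    rewrite [x \in A2]mem_set //=.
    have : `|f x - V x| <= C + K.
      by rewrite (le_trans (ler_normB _ _)) // lerD ?fC ?VK.
    have : 0 <= C * (x \in A1)%:R by rewrite mulr_ge0.
    by lra.
  rewrite [x \in A2]memNset /=; last by move=> /(_ xO).
  have [xM|xM] := pselect (lbox (const_mx M) x).
    rewrite [x \in A1]memNset /=; last by move=> /(_ xM).
    by have := Vf x (conj xO xM); rewrite distrC; lra.
  rewrite [x \in A1]mem_set //= V0 // subr0.
  by have := fC x; lra.
rewrite !Rintegral_lin // !Rintegral_indic // Rintegral_cst //.
have -> : nu A2 = 0%E := simple_orthant_null nu snu.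
have := law_tail nu m M M0 sm; rewrite -/A1 => tail.
rewrite [X in e * X](_ : _ = 1); last exact: (congr1 fine (probability_setT nu)).
rewrite /= mulr0 add0r mulr1 addrC lerD2l.
exact: ler_wpM2l.
Qed.

Section Equivalence.
Context {mu : law R d} {mun : nat -> law R d}.
Context {sigma : spmeasure R d} {sigman : nat -> spmeasure R d}.
Context (smu : simple_max_stable mu).
Context (smun : forall n, simple_max_stable (mun n)).
Context (spmu : spectral_measure_of N mu sigma).
Context (spmun : forall n, spectral_measure_of N (mun n) (sigman n)).

Lemma hfun_cvg_in_distribution :
  (forall x : 'rV[R]_d, (forall i, 0 < x ord0 i) ->
     (fun n => hfun N (sigman n) x) @ \oo --> hfun N sigma x) ->
  cvg_in_distribution mun mu.
Proof.
move=> H f cf [C fC].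
have C0 : 0 <= C by rewrite (le_trans _ (fC 0)).
have bf := bounded_continuous_bounded_measurable f C cf fC.
apply/cvg_integral_RintegralP => //.
- exact: law_fin.
- by move=> n; exact: law_fin.
apply: cvg_uniform_approx => e e0.
have e2 : 0 < e / 2 by rewrite divr_gt0.
(* Makes the tail term [C * (d / M)] at most [e / 2]; the added ones keep [M] positive. *)
pose M := 2 * (C + 1) * (d%:R + 1) / e.
have d1 : 0 < d%:R + 1 :> R by rewrite ltr_wpDl.
have M0 : 0 < M by rewrite divr_gt0 // !mulr_gt0 // ltr_wpDl.
have CM : C * (d%:R / M) <= e / 2.
  rewrite mulrA ler_pdivrMr // /M.
  rewrite (_ : e / 2 * _ = (C + 1) * (d%:R + 1)).
    by apply: ler_pM => //; rewrite lerDl.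
  by field; rewrite gt_eqF.
have [V [sV Vf _ V0]] := lbox_span_approx M C (e / 2) f M0 e2
  (continuous_subspaceT cf) (fun y _ => fC y).
exists (fun n => \int[mun n]_x V x); exists (\int[mu]_x V x); last first.
  split=> [n|].
    apply: le_trans (law_Rintegral_approx _ _ _ _ C M (e / 2) (smun n) (spmun n)
      M0 (ltW e2) cf fC sV Vf V0) _; lra.
  apply: le_trans (law_Rintegral_approx _ _ _ _ C M (e / 2) smu spmu
    M0 (ltW e2) cf fC sV Vf V0) _; lra.
(* Indicators integrate to [exp (- h_n (1/x))], whose convergence is the hypothesis; linear
   combinations follow. *)
elim: sV => [x x0|c g1 g2 s1 IH1 s2 IH2].
  have mx := measurable_lbox x.
  rewrite Rintegral_indic // (spectral_cdf normN _ _ _ spmu x0) /=.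
  rewrite (_ : (fun n => _) = fun n => expR (- hfun N (sigman n) (inv_row x))).
    apply: continuous_cvg; first exact: continuous_expR.
    by apply: cvgN; apply: H => i; rewrite mxE invr_gt0.
  by apply: funext => n; rewrite Rintegral_indic // (spectral_cdf normN _ _ _ (spmun n) x0).
have b1 := lbox_span_bounded_measurable setT _ s1.
have b2 := lbox_span_bounded_measurable setT _ s2.
rewrite Rintegral_lin //; last exact: law_fin.
rewrite (_ : (fun n => _) = fun n => c * \int[mun n]_x g1 x + \int[mun n]_x g2 x).
  by apply: cvgD => //; exact: cvgMr.
by apply: funext => n; rewrite Rintegral_lin //; exact: law_fin.
Qed.

(** The cutoff lies between the indicators of the boxes with corners [1/w] and [(1+e)/w], so by
    homogeneity its integral lies between [exp (- h(w))] and [exp (- h(w) / (1+e))]. *)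
Lemma law_cutoff_bounds (nu : law R d) (m : spmeasure R d) (f : 'rV[R]_d -> R)
    (w : 'rV[R]_d) (e : R) : spectral_measure_of N nu m -> 0 < e ->
  (forall i, 0 < w ord0 i) -> continuous f -> (forall y, 0 <= f y <= 1) ->
  (forall y, lbox (inv_row w) y -> f y = 1) ->
  (forall y, ~ lbox ((1 + e) *: inv_row w) y -> f y = 0) ->
  [/\ 0 < \int[nu]_x f x, hfun N m w / (1 + e) <= - ln (\int[nu]_x f x)
    & - ln (\int[nu]_x f x) <= hfun N m w].
Proof.
move=> sm e0 w0 cf f01 f1 f0; have nm := spectral_normalized _ _ sm.
have fb y : `|f y| <= 1 by have /andP[a b] := f01 y; rewrite ger0_norm.
have bf := bounded_continuous_bounded_measurable f 1 cf fb.
have intf h : bounded_measurable setT h -> nu.-integrable setT (EFin \o h).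
  by apply: bounded_measurable_integrable => //; exact: law_fin.
have fle (z : 'rV[R]_d) : (forall y, lbox z y -> f y = 1) -> fine (nu (lbox z)) <= \int[nu]_x f x.
  move=> fz; have mz := measurable_lbox z.
  rewrite -Rintegral_indic //; apply: le_Rintegral => //; try exact: intf.
    exact/intf/indic_bounded_measurable.
  move=> y _; rewrite indicE; have [/set_mem yz|yz] := boolP (y \in _).
    by rewrite fz.
  by have /andP[] := f01 y.
have fge (z : 'rV[R]_d) : (forall y, ~ lbox z y -> f y = 0) -> \int[nu]_x f x <= fine (nu (lbox z)).
  move=> fz; have mz := measurable_lbox z.
  rewrite -Rintegral_indic //; apply: le_Rintegral => //; try exact: intf.
    exact/intf/indic_bounded_measurable.
  move=> y _; rewrite indicE; have [yz|/negP yz] := boolP (y \in _).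
    by have /andP[] := f01 y.
  by rewrite fz // => h; apply: yz; exact/mem_set.
have p1 : 0 < 1 + e by rewrite addr_gt0.
have iw : inv_row (inv_row w) = w by apply/rowP => i; rewrite !mxE invrK.
have iwe : inv_row ((1 + e) *: inv_row w) = (1 + e)^-1 *: w.
  by apply/rowP => i; rewrite !mxE invfM invrK.
have lo := fle _ f1; have hi := fge _ f0.
rewrite (spectral_cdf normN _ _ _ sm) ?iw /= in lo; last first.
  by move=> i; rewrite mxE invr_gt0.
rewrite (spectral_cdf normN _ _ _ sm) ?iwe /= in hi; last first.
  by move=> i; rewrite !mxE mulr_gt0 // invr_gt0.
have ie : 0 <= (1 + e)^-1 by rewrite invr_ge0 ltW.
rewrite (hfunZ normN nm _ _ ie) (mulrC (1 + e)^-1) in hi.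
have I0 : 0 < \int[nu]_x f x by apply: lt_le_trans lo; exact: expR_gt0.
split=> //.
  by rewrite lerNr -[leRHS]expRK ler_ln // posrE // expR_gt0.
by rewrite lerNl -[leLHS]expRK ler_ln // posrE // expR_gt0.
Qed.

Lemma cvg_in_distribution_hfun : cvg_in_distribution mun mu ->
  forall x : 'rV[R]_d, (forall i, 0 < x ord0 i) ->
    (fun n => hfun N (sigman n) x) @ \oo --> hfun N sigma x.
Proof.
move=> H w w0; apply: cvg_uniform_approx => eta eta0.
pose D := \sum_(i < d) `|w ord0 i|.
have D0 : 0 <= D by exact: sumr_ge0.
have D1 : 0 < D + 1 by rewrite ltr_wpDl.
(* The two bounds for [h(w)] differ by [h(w) * e / (1 + e)], and [h(w) <= D] for every law
   involved. *)
pose e := eta / (D + 1).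
have e0 : 0 < e by rewrite divr_gt0.
have p1 : 0 < 1 + e by rewrite addr_gt0.
(* A linear ramp in [maxlin y w], falling from 1 to 0 between the levels 1 and [1 + e]; the sublevel
   sets of [maxlin y w] at these levels are exactly the two boxes. *)
pose f (y : 'rV[R]_d) : R := Num.min 1 (Num.max 0 ((1 + e - maxlin y w) * e^-1)).
have cf : continuous f.
  move=> y; apply: (@continuous_min _ _ (fun=> 1) (fun y => Num.max 0 ((1 + e - maxlin y w) * e^-1))).
    exact: cst_continuous.
  apply: (@continuous_max _ _ (fun=> 0) (fun y => (1 + e - maxlin y w) * e^-1)).
    exact: cst_continuous.
  apply: continuousM; last exact: cst_continuous.
  apply: continuousB; first exact: cst_continuous.
  exact: maxlin_continuous.
have f01 y : 0 <= f y <= 1.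
  by rewrite /f ge_min lexx /= andbT le_min ler01 le_max lexx.
have iww i t : (t <= (inv_row w) ord0 i) = (t * w ord0 i <= 1).
  by rewrite mxE -[X in t <= X]mul1r ler_pdivlMr.
have f1 y : lbox (inv_row w) y -> f y = 1.
  move=> yw; have : maxlin y w <= 1.
    by apply: maxlin_le => // i; rewrite -iww.
  move=> h; apply: min_l; rewrite le_max; apply/orP; right.
  by rewrite ler_pdivlMr //; lra.
have f0 y : ~ lbox ((1 + e) *: inv_row w) y -> f y = 0.
  move=> /existsNP[i /negP]; rewrite -ltNge !mxE ltr_pdivrMr // => yi.
  have := maxlin_ge y w i => h.
  rewrite /f [Num.max _ _]max_l ?min_r //.
  by rewrite pmulr_lle0 ?invr_gt0 //; lra.
have fb y : `|f y| <= 1 by have /andP[a b] := f01 y; rewrite ger0_norm.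
have bf := bounded_continuous_bounded_measurable f 1 cf fb.
have key nu m : spectral_measure_of N nu m -> `|hfun N m w - (- ln (\int[nu]_x f x))| <= eta.
  move=> sm; have nm := spectral_normalized _ _ sm.
  have [_ l u] := law_cutoff_bounds nu m f w e sm e0 w0 cf f01 f1 f0.
  rewrite ger0_norm ?subr_ge0 // (@le_trans _ _ (hfun N m w - hfun N m w / (1 + e))) ?lerB //.
  have hD : hfun N m w <= D := hfun_le normN nm w.
  have h0 := hfun_ge0 (N := N) (m := m) w.
  rewrite (_ : _ - _ = hfun N m w * (e / (1 + e))); last by field; rewrite gt_eqF.
  have e1 : e / (1 + e) <= e.
    by rewrite ler_pdivrMr // ler_peMr ?ltW //; lra.
  apply: (@le_trans _ _ ((D + 1) * e)).
    apply: ler_pM => //; first by rewrite divr_ge0 // ltW.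
    by lra.
  by rewrite mulrC /e divfK // gt_eqF.
exists (fun n => - ln (\int[mun n]_x f x)); exists (- ln (\int[mu]_x f x)); last first.
  by split => [n|]; exact: key.
(* Positivity of the limit integral gives continuity of [ln] there. *)
have [I0 _ _] := law_cutoff_bounds mu sigma f w e spmu e0 w0 cf f01 f1 f0.
apply: cvgN; apply: continuous_cvg; first exact: continuous_ln.
apply/cvg_integral_RintegralP => //; first exact: law_fin.
  by move=> n; exact: law_fin.
by apply: H => //; exists 1.
Qed.

End Equivalence.

End Distribution.

(** * Weak convergence of the spectral measures *)

Section Weak.
Context {R : realType} {d : nat} {N : 'rV[R]_d -> R}.
Context (normN : is_norm N).
Local Notation S := (Ssph N : set (Borel R d)).
Local Notation leb := (@lebesgue_measure R).

(** Turns the length [max (|a|, m) - m] met on a ray into a difference of two values of [maxlin a],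
    hence after integration of [hfun]. *)
Lemma maxlin_max1 (a w : 'rV[R]_d) : orthant a ->
  maxlin a (\row_i Num.max 1 (w ord0 i)) = Num.max `|a| (maxlin a w).
Proof.
move=> a0; apply/eqP; rewrite eq_le; apply/andP; split.
  apply: maxlin_le => [|i]; first by rewrite le_max normr_ge0.
  rewrite mxE maxr_pMr // mulr1 ge_max !le_max maxlin_ge orbT andbT.
  by rewrite (le_trans (ler_norm _) (coord_le_norm a i)).
have le1 i (t : R) : t <= Num.max 1 (w ord0 i) ->
    a ord0 i * t <= maxlin a (\row_i Num.max 1 (w ord0 i)).
  move=> ht; apply: le_trans (maxlin_ge _ _ i); rewrite mxE.
  exact: ler_wpM2l.
rewrite ge_max; apply/andP; split.
  apply: norm_le_coord => [|i]; first exact: maxlin_ge0.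
  by rewrite ger0_norm // -[a ord0 i]mulr1 le1 // le_max lexx.
apply: maxlin_le => [|i]; first exact: maxlin_ge0.
by rewrite le1 // le_max lexx orbT.
Qed.

Lemma lebesgue_itv_oo0 (b : R) : 0 <= b -> leb `]0, b[ = b%:E.
Proof.
move=> b0; rewrite lebesgue_measure_itv /= lte_fin.
by case: ltgtP b0 => // [_ _|<- _]; rewrite ?sube0 ?oppr0 ?adde0.
Qed.

Lemma lebesgue_itv_oo0_fin (b : R) : 0 <= b -> (leb `]0%R, b[ < +oo)%E.
Proof. by move=> b0; rewrite lebesgue_itv_oo0 // ltry. Qed.

(** For [u > 0], [a / u] lies in the box exactly when [u >= m], with [m = maxlin a (inv_row x)]. The
    integral is thus the length of the part of the interval above [m], which is 0 if [m >= |a|]. *)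
Lemma lbox_ray_integral (a x : 'rV[R]_d) : orthant a -> 0 < `|a| ->
  (forall i, 0 < x ord0 i) ->
  bounded_measurable (`]0, `|a|[%classic : set (measurableTypeR R))
    (fun u : R => \1_(lbox x) (u^-1 *: a) : R) /\
  \int[leb]_(u in `]0, `|a|[) (\1_(lbox x) (u^-1 *: a) : R) =
    maxlin a (\row_i Num.max 1 ((inv_row x) ord0 i)) - maxlin a (inv_row x).
Proof.
move=> a0 an x0; pose m := maxlin a (inv_row x).
have mp : 0 < m.
  rewrite lt_neqAle maxlin_ge0 andbT eq_sym; apply: contraTneq an => m0.
  rewrite -leNgt; apply: norm_le_coord => // i; rewrite ger0_norm //.
  have := maxlin_ge a (inv_row x) i; rewrite -/m m0 mxE.
  by rewrite pmulr_lle0 // invr_gt0.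
have E : {in (`]0, `|a|[%classic : set (measurableTypeR R)), (fun u : R => \1_(lbox x) (u^-1 *: a) : R) =1
    (\1_(`[m, +oo[%classic) : R -> R)}.
  move=> u; rewrite inE /= in_itv /= => /andP[u0 _].
  have ray i : (u^-1 * a ord0 i <= x ord0 i) = (a ord0 i / x ord0 i <= u).
    by rewrite mulrC !ler_pdivrMr // mulrC.
  rewrite !indicE; congr (_%:R); congr nat_of_bool; apply/idP/idP.
    move=> /set_mem h; apply/mem_set; rewrite /= in_itv /= andbT.
    apply: maxlin_le => [|i]; first exact: ltW.
    by have := h i; rewrite !mxE ray.
  move=> /set_mem; rewrite /= in_itv /= andbT => h; apply/mem_set => i.
  have := le_trans (maxlin_ge a (inv_row x) i) h.
  by rewrite !mxE ray.
split; first split.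
- apply: (eq_measurable_fun (\1_(`[m, +oo[%classic) : R -> R)).
    by move=> u /E ->.
  exact: measurable_indic.
- by exists 1 => u _; rewrite indicE normr_nat; case: (_ \in _).
transitivity (\int[leb]_(u in `]0, `|a|[) (\1_(`[m, +oo[%classic) u : R)).
  exact: eq_Rintegral.
rewrite /Rintegral integral_indic //.
transitivity (fine (leb `[m, `|a|[)).
  congr (fine (leb _)); apply/seteqP; split=> u /=; rewrite !in_itv /= ?andbT.
    by move=> [-> /andP[]].
  by move=> /andP[mu ->]; rewrite mu (lt_le_trans mp mu).
rewrite lebesgue_measure_itv /= lte_fin maxlin_max1 // -/m.
by case: ltP => h; rewrite ?subrr.
Qed.

Context {sigma : spmeasure R d} {sigman : nat -> spmeasure R d}.
Context (ns : normalized N sigma).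
Context (nsn : forall n, normalized N (sigman n)).

Lemma weak_cvg_hfun : weak_cvg_on (Ssph N) sigman sigma ->
  forall x : 'rV[R]_d, (fun n => hfun N (sigman n) x) @ \oo --> hfun N sigma x.
Proof.
move=> H x; have bx := maxlin_bounded_measurable normN x.
have mS := measurable_Ssph normN.
apply/(cvg_integral_RintegralP S (fun a => maxlin a x)) => //.
- exact: Ssph_mass_fin.
- by move=> n; exact: Ssph_mass_fin.
apply: H; first exact/continuous_subspaceT/maxlin_continuous.
by have [] := bx.
Qed.

Context (hcvg : forall x : 'rV[R]_d, (forall i, 0 < x ord0 i) ->
  (fun n => hfun N (sigman n) x) @ \oo --> hfun N sigma x).

(** [W] is built along the derivation of [V] as a linear combination of functions [maxlin _ x] with
    positive [x]. Its measurability and the convergence of its integrals come from there, with no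
    exchange of integrals. *)
Lemma lbox_span_ray_integral (V : 'rV[R]_d -> R) : lbox_span V ->
  exists W : 'rV[R]_d -> R, [/\ bounded_measurable S W,
    (fun n => \int[sigman n]_(a in S) W a) @ \oo --> \int[sigma]_(a in S) W a &
    forall a, Ssph N a ->
      bounded_measurable (`]0, `|a|[%classic : set (measurableTypeR R)) (fun u : R => V (u^-1 *: a)) /\
      \int[leb]_(u in `]0, `|a|[) V (u^-1 *: a) = W a].
Proof.
have mS := measurable_Ssph normN.
have fins := Ssph_mass_fin normN ns.
have finsn n := Ssph_mass_fin normN (nsn n).
have lin c (W1 W2 : 'rV[R]_d -> R) :
    bounded_measurable S W1 -> bounded_measurable S W2 ->
    (fun n => \int[sigman n]_(a in S) W1 a) @ \oo --> \int[sigma]_(a in S) W1 a ->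
    (fun n => \int[sigman n]_(a in S) W2 a) @ \oo --> \int[sigma]_(a in S) W2 a ->
    (fun n => \int[sigman n]_(a in S) (c * W1 a + W2 a)) @ \oo -->
      \int[sigma]_(a in S) (c * W1 a + W2 a).
  move=> b1 b2 c1 c2; rewrite Rintegral_lin //.
  rewrite (_ : (fun n => _) = fun n => c * \int[sigman n]_(a in S) W1 a +
    \int[sigman n]_(a in S) W2 a).
    by apply: cvgD => //; exact: cvgMr.
  by apply: funext => n; rewrite Rintegral_lin.
elim => [x x0|c g1 g2 s1 [W1 [b1 c1 E1]] s2 [W2 [b2 c2 E2]]].
  pose w' : 'rV[R]_d := \row_i Num.max 1 ((inv_row x) ord0 i).
  have bm z := maxlin_bounded_measurable normN z.
  exists (fun a => -1 * maxlin a (inv_row x) + maxlin a w'); split.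
  - exact: bounded_measurable_lin.
  - by apply: lin => //; apply: hcvg => i; rewrite !mxE ?lt_max ?ltr01 // invr_gt0.
  - move=> a Sa; have [c c0 [B B0 HB]] := Ssph_norm_bounds normN.
    have /andP[ca _] := HB a Sa.
    have [h1 ->] := lbox_ray_integral a x (proj1 Sa) (lt_le_trans c0 ca) x0.
    by split => //; rewrite mulN1r addrC.
exists (fun a => c * W1 a + W2 a); split.
- exact: bounded_measurable_lin.
- exact: lin.
- move=> a Sa; have [m1 e1] := E1 a Sa; have [m2 e2] := E2 a Sa.
  split; first exact: bounded_measurable_lin.
  rewrite Rintegral_lin ?e1 ?e2 //.
  exact: lebesgue_itv_oo0_fin.
Qed.

(* [cone_ext f] agrees with [f (y / N y) / `|y / N y|] off the unit cube, so
   that integrating it over [u] in ]0, `|a|[ along the ray [a / u] gives back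
   [f a]; the factor [min 1 `|y|] makes it continuous at the origin. *)
Definition cone_ext (f : 'rV[R]_d -> R) (y : 'rV[R]_d) : R :=
  Num.min 1 `|y| * (N y / `|y|) * f ((N y)^-1 *: y).

Lemma normalize_Ssph (y : 'rV[R]_d) : orthant y -> y != 0 ->
  Ssph N ((N y)^-1 *: y).
Proof.
move=> y0 yn; have [h0 _ hZ] := normN.
have Ny : 0 < N y.
  rewrite lt_neqAle (norm_fun_ge0 normN) andbT eq_sym.
  by apply: contra yn => /eqP/h0/eqP.
split; first by move=> i; rewrite mxE mulr_ge0 // invr_ge0 ltW.
by rewrite hZ ger0_norm ?invr_ge0 ?ltW // mulVf // gt_eqF.
Qed.

Lemma cone_ext_ray f (a : 'rV[R]_d) (u : R) : Ssph N a -> 0 < u -> u < `|a| ->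
  cone_ext f (u^-1 *: a) = f a / `|a|.
Proof.
move=> [a0 Na] u0 ua; have [_ _ hZ] := normN.
have ap : 0 < `|a| by exact: lt_trans ua.
rewrite /cone_ext hZ Na mulr1 normrZ gtr0_norm ?invr_gt0 // invrK scalerA.
rewrite divff ?gt_eqF // scale1r min_l.
  by field; rewrite !gt_eqF.
by rewrite mulrC ler_pdivlMr // mul1r ltW.
Qed.

(** Away from the origin this is a product of continuous factors; near it
    [|cone_ext f y| <= |y| * K * |C|]. *)
Lemma cone_ext_continuous f (C : R) : {within Ssph N, continuous f} ->
  (forall a, Ssph N a -> `|f a| <= C) -> {within orthant, continuous (cone_ext f)}.
Proof.
move=> cf fC; have [K K0 HK] := norm_fun_upper normN.
have [h0 _ _] := normN.
apply/subspace_continuousP => x x0.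
change (cone_ext f y @[y --> within orthant (nbhs x)] --> cone_ext f x).
have [xe|xn] := eqVneq x 0.
  have -> : cone_ext f x = 0 by rewrite xe /cone_ext normr0 min_r // !mul0r.
  apply/cvgrPdist_le => e e0; rewrite near_withinE; apply/nbhs_ballP.
  have KC : 0 < K * `|C| + 1 by rewrite ltr_wpDl // mulr_ge0 // ltW.
  exists (e / (K * `|C| + 1)); first by rewrite /= divr_gt0.
  move=> y; rewrite mx_norm_ball /ball_ /= xe sub0r normrN ltr_pdivlMr // => ye y0.
  rewrite sub0r normrN /cone_ext; have [->|yn] := eqVneq y 0.
    by rewrite normr0 min_r // !mul0r normr0 ltW.
  have yp : 0 < `|y| by rewrite normr_gt0.
  have fy := fC _ (normalize_Ssph y y0 yn).
  rewrite !normrM; apply: (@le_trans _ _ (`|y| * K * `|C|)).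
    apply: ler_pM; rewrite ?mulr_ge0 //.
      apply: ler_pM; rewrite ?mulr_ge0 //.
        by rewrite ger0_norm ?ge_min ?lexx ?orbT // le_min ler01 normr_ge0.
      rewrite ger0_norm ?(norm_fun_ge0 normN) // normfV normr_id.
      by rewrite ler_pdivrMr.
    by rewrite (le_trans fy) // ler_norm.
  rewrite -mulrA; apply: le_trans (ltW ye).
  by rewrite ler_wpM2l // lerDl.
have Nx : N x != 0 by apply: contra xn => /eqP/h0/eqP.
have nx : `|x| != 0 by rewrite normr_eq0.
have cN : N y @[y --> within orthant (nbhs x)] --> N x.
  exact: cvg_trans (cvg_app N (@cvg_within _ _ _ _)) (norm_fun_continuous normN x).
have cn : `|y| @[y --> within orthant (nbhs x)] --> `|x|.
  exact: cvg_trans (cvg_app _ (@cvg_within _ _ _ _)) (@norm_continuous _ _ x).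
have cy : y @[y --> within orthant (nbhs x)] --> x by exact: cvg_within.
have cr : (N y)^-1 *: y @[y --> within orthant (nbhs x)] --> (N x)^-1 *: x.
  by apply: cvgZ => //; exact: cvgV.
have cmin : Num.min 1 t @[t --> `|x|] --> Num.min 1 `|x|.
  apply: (@continuous_min _ _ (fun=> 1) id); first exact: cst_continuous.
  exact: cvg_id.
have cm : Num.min 1 `|y| @[y --> within orthant (nbhs x)] --> Num.min 1 `|x|.
  exact: cvg_comp cn cmin.
apply: cvgM.
  by apply: cvgM cm _; apply: cvgM cN _; exact: cvgV nx cn.
apply/cvgrPdist_le => e e0.
have /within_continuous_epsP/(_ _ (normalize_Ssph x x0 xn) _ e0)[r r0 Hr] := cf.
have /cvgrPdist_lt/(_ _ r0) := cr.
rewrite !near_withinE => cr'.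
have xn' : \forall y \near x, y != 0.
  apply/nbhs_ballP; exists `|x|; first by rewrite /= normr_gt0.
  move=> y; rewrite mx_norm_ball /ball_ /= => xy; apply: contraTneq xy => ->.
  by rewrite subr0 ltxx.
apply: filterS2 xn' cr' => y yn yr y0.
by apply: Hr; [exact: normalize_Ssph|exact: yr].
Qed.

Lemma hfun_weak_cvg : weak_cvg_on (Ssph N) sigman sigma.
Proof.
have mS := measurable_Ssph normN.
have fins := Ssph_mass_fin normN ns.
have finsn n := Ssph_mass_fin normN (nsn n).
move=> f cf [C fC].
have bf := continuous_bounded_measurable normN f C cf fC.
have [c c0 [B B0 HB]] := Ssph_norm_bounds normN.
have [mass massP] := Ssph_mass_bound normN.
have [K K0 HK] := norm_fun_upper normN.
apply/(cvg_integral_RintegralP S f) => //.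
apply: cvg_uniform_approx => e e0.
have mass1 : 0 < `|mass| + 1 by rewrite ltr_wpDl.
(* [eta] is the error allowed between [f] and [W] on the sphere, given the common mass bound. Half
   of it is [eps] times the length [|a| <= B] of the ray interval; the other half is [D], a bound
   for [|f a| / |a|], times the length at most [B / M] of the part where [a / u] leaves the box. *)
pose eta := e / (`|mass| + 1).
have eta0 : 0 < eta by rewrite divr_gt0.
pose D := `|C| / c.
have D0 : 0 <= D by rewrite divr_ge0 // ltW.
pose eps := eta / (2 * B).
have eps0 : 0 < eps by rewrite divr_gt0 // mulr_gt0.
pose M := 2 * B * (D + 1) / eta.
have M0 : 0 < M by rewrite divr_gt0 // !mulr_gt0 // ltr_wpDl.
have ccf : {within pbox M, continuous (cone_ext f)}.
  apply: continuous_subspaceW (cone_ext_continuous f C cf fC).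
  by move=> y [].
have cfb y : pbox M y -> `|cone_ext f y| <= K * `|C|.
  move=> [y0 _]; rewrite /cone_ext; have [->|yn] := eqVneq y 0.
    by rewrite normr0 min_r // !mul0r normr0 mulr_ge0 // ltW.
  have yp : 0 < `|y| by rewrite normr_gt0.
  have fy := fC _ (normalize_Ssph y y0 yn).
  rewrite !normrM; apply: ler_pM; rewrite ?mulr_ge0 //.
    rewrite -[K]mul1r; apply: ler_pM; rewrite ?mulr_ge0 //.
      by rewrite ger0_norm ?ge_min ?lexx // le_min ler01 normr_ge0.
    rewrite ger0_norm ?(norm_fun_ge0 normN) // normfV normr_id.
    by rewrite ler_pdivrMr.
  by rewrite (le_trans fy) // ler_norm.
have [V [sV Vf _ V0]] := lbox_span_approx M (K * `|C|) eps (cone_ext f) M0 eps0 ccf cfb.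
have [W [bW cW HW]] := lbox_span_ray_integral V sV.
(* Both numbers are integrals over [u] in []0, |a|[]: [f a] of the constant [f a / |a|], which is
   [cone_ext f (a / u)], and [W a] of [V (a / u)]. *)
have fW a : Ssph N a -> `|f a - W a| <= eta.
  move=> Sa; have [a0 Na] := Sa; have /andP[ca aB] := HB a Sa.
  have ap : 0 < `|a| by exact: lt_le_trans ca.
  have [bV <-] := HW a Sa.
  pose I : set (measurableTypeR R) := `]0, `|a|[%classic.
  pose A : set (measurableTypeR R) := `]0, `|a| / M[%classic.
  have finI : (leb I < +oo)%E by apply: lebesgue_itv_oo0_fin.
  have fI : fine (leb I) = `|a| by rewrite /I lebesgue_itv_oo0.
  have mI : measurable I by exact: measurable_itv.
  have mA : measurable A by exact: measurable_itv.
  have bc (t : R) : bounded_measurable I (fun=> t).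
    by split; [exact: measurable_cst|exists `|t|].
  have bA : bounded_measurable I (\1_A : R -> R).
    split; first exact: measurable_indic.
    by exists 1 => u _; rewrite indicE normr_nat; case: (_ \in _).
  have -> : f a = \int[leb]_(u in I) (f a / `|a|).
    rewrite Rintegral_cst // [X in _ * X](_ : _ = `|a|); last exact: fI.
    by rewrite divfK // gt_eqF.
  have bAc := bounded_measurable_lin I D _ _ bA (bc eps).
  have key := Rintegral_dist_le_fun I leb (fun=> f a / `|a|)
    (fun u => V (u^-1 *: a)) _ mI finI (bc _) bV bAc.
  refine (le_trans (key _) _).
    move=> u; rewrite /I /= in_itv /= => /andP[u0 ua].
    have yO : orthant (u^-1 *: a).
      by move=> i; rewrite mxE mulr_ge0 // invr_ge0 ltW.
    rewrite indicE -(cone_ext_ray f a u Sa u0 ua).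
    have [yM|yM] := pselect (lbox (const_mx M) (u^-1 *: a)).
      have := Vf _ (conj yO yM); rewrite distrC.
      have : 0 <= D * (u \in A)%:R by rewrite mulr_ge0.
      by lra.
    rewrite V0 // subr0 (cone_ext_ray f a u Sa u0 ua) mem_set /=; last first.
      (* Some coordinate satisfies [a_i / u > M], which forces [u < |a| / M]. *)
      move/existsNP: yM => [i /negP]; rewrite -ltNge !mxE => yM.
      rewrite /A /= in_itv /= u0 ltr_pdivlMr // -ltr_pdivlMl //.
      apply: lt_le_trans yM _; apply: ler_wpM2l; first by rewrite invr_ge0 ltW.
      exact: le_trans (ler_norm _) (coord_le_norm a i).
    rewrite mulr1 normrM normfV normr_id.
    have : `|f a| / `|a| <= D.
      apply: ler_pM => //; first exact: le_trans (fC a Sa) (ler_norm _).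
      by rewrite lef_pV2 ?posrE.
    by lra.
  rewrite (Rintegral_lin I leb D) // Rintegral_cst //.
  rewrite [X in eps * X](_ : _ = `|a|); last exact: fI.
  have IA : \int[leb]_(u in I) (\1_A u : R) <= `|a| / M.
    rewrite /Rintegral integral_indic //.
    have AM : leb A = (`|a| / M)%:E by apply: lebesgue_itv_oo0; rewrite divr_ge0 // ltW.
    have AI : (leb (A `&` I) <= leb A)%E.
      by apply: le_measure; rewrite ?inE //; exact: measurableI.
    rewrite -lee_fin -AM fineK //.
    rewrite ge0_fin_numE //; apply: le_lt_trans AI _.
    by rewrite AM ltry.
  apply: (@le_trans _ _ (D * (B / M) + eps * B)).
    apply: lerD; last by rewrite ler_wpM2l // ltW.
    apply: ler_wpM2l => //; apply: le_trans IA _.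
    by rewrite ler_wpM2r // invr_ge0 ltW.
  have -> : eps * B = eta / 2 by rewrite /eps; field; rewrite gt_eqF.
  have : D * (B / M) <= eta / 2.
    rewrite (_ : D * (B / M) = D / (D + 1) * (eta / 2)); last first.
      rewrite /M; field.
      by rewrite !gt_eqF // ltr_wpDl.
    apply: ler_piMl; first by rewrite divr_ge0 // ltW.
    by rewrite ler_pdivrMr ?mul1r ?lerDl // ltr_wpDl.
  by lra.
have dist (m : spmeasure R d) : normalized N m ->
    `|\int[m]_(a in S) f a - \int[m]_(a in S) W a| <= e.
  move=> nm; have finm := Ssph_mass_fin normN nm.
  apply: le_trans (Rintegral_dist_le S m eta f W mS finm bf bW fW) _.
  have h : fine (m S) <= `|mass| + 1.
    rewrite (le_trans (massP m nm)) // (le_trans (ler_norm _)) //.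
    by rewrite lerDl.
  apply: (@le_trans _ _ (eta * (`|mass| + 1))).
    by rewrite ler_wpM2l // ltW.
  by rewrite /eta divfK // gt_eqF.
exists (fun n => \int[sigman n]_(a in S) W a); exists (\int[sigma]_(a in S) W a) => //.
by split => [n|]; exact: dist.
Qed.

End Weak.

(** * Hausdorff convergence of the dependency sets *)

Section Hausdorff.
Context {R : realType} {d : nat} {N : 'rV[R]_d -> R}.
Context (normN : is_norm N).

Definition dotp (y x : 'rV[R]_d) : R := \sum_(i < d) y ord0 i * x ord0 i.

Lemma dotpBl y z x : dotp (y - z) x = dotp y x - dotp z x.
Proof. by rewrite /dotp -sumrB; apply: eq_bigr => i _; rewrite !mxE mulrBl. Qed.

Lemma dotpC x y : dotp x y = dotp y x.
Proof. by apply: eq_bigr => i _; rewrite mulrC. Qed.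

Lemma dotpZl c y x : dotp (c *: y) x = c * dotp y x.
Proof. by rewrite /dotp mulr_sumr; apply: eq_bigr => i _; rewrite mxE mulrA. Qed.

Lemma dotp_ge0 x : 0 <= dotp x x.
Proof. by apply: sumr_ge0 => i _; rewrite -expr2 sqr_ge0. Qed.

Lemma dotp_sq_sub x t w :
  dotp (x - t *: w) (x - t *: w) = dotp x x - 2 * t * dotp x w + t ^+ 2 * dotp w w.
Proof.
rewrite dotpBl dotpZl (dotpC x) (dotpC w) !dotpBl !dotpZl (dotpC w x).
ring.
Qed.

Lemma dotp_le_norm v x : dotp v x <= `|v| * \sum_(i < d) `|x ord0 i|.
Proof.
rewrite mulr_sumr; apply: ler_sum => i _; rewrite (le_trans (ler_norm _)) //.
by rewrite normrM ler_wpM2r // coord_le_norm.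
Qed.

Lemma dotp_self_continuous (y : 'rV[R]_d) :
  continuous (fun z : 'rV[R]_d => dotp (y - z) (y - z)).
Proof.
move=> z; rewrite /dotp; elim: (index_enum _) => [|i s IHs].
  rewrite (_ : (fun _ => _) = fun=> 0); first exact: (@cst_continuous _ R^o 0 z).
  by apply: funext => u; rewrite big_nil.
under eq_fun do rewrite big_cons.
apply: (@continuousD _ R^o _ (fun u : 'rV[R]_d => (y - u) ord0 i * (y - u) ord0 i)
  (fun u : 'rV[R]_d => \sum_(j <- s) (y - u) ord0 j * (y - u) ord0 j)) => //.
have h : {for z, continuous (fun u : 'rV[R]_d => (y - u) ord0 i)}.
  rewrite (_ : (fun u => _) = fun u : 'rV[R]_d => y ord0 i - u ord0 i).
    by apply: continuousB; [exact: cst_continuous|exact: coord_continuous].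
  by apply: funext => u; rewrite !mxE.
exact: continuousM.
Qed.

(** * Geometry of a single dependency set *)

Section DependencySet.
Context {m : spmeasure R d} {K : set 'rV[R]_d}.
Context (nm : normalized N m).
Context (depK : dependency_set_of N m K).

Lemma dependency_support x : orthant x ->
  support_fun K x = (hfun N m x)%:E.
Proof.
have [_ _ _ _ h] := depK; move=> x0; rewrite h // -integral_maxlin //.
Qed.

Lemma dependency_dotp_le y x : K y -> orthant x -> dotp y x <= hfun N m x.
Proof.
move=> Ky x0; rewrite -lee_fin -dependency_support //.
by apply: ereal_sup_ubound; exists y.
Qed.

Lemma dependency_hfun_le x (c : R) : orthant x ->
  (forall y, K y -> dotp y x <= c) -> hfun N m x <= c.
Proof.
move=> x0 H; rewrite -lee_fin -dependency_support //.
by apply: ge_ereal_sup => _ [y Ky <-]; rewrite lee_fin; exact: H.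
Qed.

(** The support function of the empty set would lie below [-1] at 0, whereas [hfun] is
    nonnegative. *)
Lemma dependency_nonempty : K !=set0.
Proof.
apply: contrapT => K0; have x0 : orthant (0 : 'rV[R]_d) by move=> i; rewrite mxE.
have := dependency_hfun_le 0 (-1) x0.
have := hfun_ge0 (N := N) (m := m) 0 => h1 h2.
have : hfun N m 0 <= -1 by apply: h2 => y Ky; exfalso; apply: K0; exists y.
by lra.
Qed.

Lemma dependency_coord_le1 y i : K y -> 0 <= y ord0 i <= 1.
Proof.
move=> Ky; have [_ _ KO _ _] := depK; rewrite KO //=.
have x0 : orthant (delta_mx 0 i : 'rV[R]_d).
  by move=> j; rewrite mxE; case: (_ && _).
have := dependency_dotp_le y _ Ky x0.
rewrite /dotp (bigD1 i) //= big1 => [|j ji]; last first.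
  by rewrite mxE (negbTE ji) andbF mulr0.
rewrite mxE !eqxx mulr1 addr0 => /le_trans; apply.
apply: (le_trans (hfun_le normN nm _)).
rewrite (bigD1 i) //= big1 => [|j ji]; last by rewrite mxE (negbTE ji) andbF normr0.
by rewrite mxE !eqxx normr1 addr0.
Qed.

(* The Euclidean projection [p] of [y] onto [K]; lower-closedness of [K] makes
   the outer normal [y - p] nonnegative, where [h] is the support function. *)
Lemma dependency_projection y : orthant y -> exists2 p, K p &
  orthant (y - p) /\ dotp (y - p) (y - p) <= dotp y (y - p) - hfun N m (y - p).
Proof.
move=> y0; have [cK convK KO lowK _] := depK.
have [p /set_mem Kp pmin] := EVT_min_rV dependency_nonempty cK
  (continuous_subspaceT (dotp_self_continuous y)).
have var z : K z -> dotp (y - p) (z - p) <= 0.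
  move=> Kz; rewrite leNgt; apply/negP => s0.
  set s := dotp _ _ in s0; pose Q := dotp (z - p) (z - p).
  have Q0 : 0 <= Q by exact: dotp_ge0.
  have sQ : 0 < s + Q by rewrite ltr_pwDl.
  (* A step from [p] towards [z] that stays in the segment: minimality gives [2 s <= t Q], whereas
     [t Q = s - t s] is less than [2 s]. *)
  pose t := s / (s + Q).
  have t0 : 0 < t by rewrite divr_gt0.
  have t1 : t <= 1 by rewrite ler_pdivrMr // mul1r lerDl.
  have Kt : K (t *: z + (1 - t) *: p) by apply: convK => //; rewrite t1 ltW.
  have := pmin _ (mem_set Kt).
  rewrite (_ : y - (t *: z + (1 - t) *: p) = (y - p) - t *: (z - p)); last first.
    by apply/rowP => i; rewrite !mxE; ring.
  rewrite dotp_sq_sub -/s -/Q => h.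
  have tQ : t * (s + Q) = s by rewrite /t divfK // gt_eqF.
  have : t * (2 * s - t * Q) <= 0 by lra.
  by rewrite pmulr_rle0 //; nra.
have xO : orthant (y - p).
  move=> i; rewrite leNgt; apply/negP; rewrite !mxE => yp.
  (* If [y_i < p_i], lowering the coordinate [p_i] to [y_i] stays in [K], and the variational
     inequality at this point reads [(y_i - p_i)^2 <= 0]. *)
  pose z : 'rV[R]_d := \row_j if j == i then y ord0 i else p ord0 j.
  have Kz : K z.
    apply: (lowK p) => // j; rewrite mxE; case: eqP => [ji|_] //.
      exact: KO.
    by rewrite ji; move: yp; lra.
  have := var z Kz; rewrite /dotp (bigD1 i) //= big1 => [|j ji]; last first.
    by rewrite !mxE (negbTE ji) subrr mulr0.
  rewrite !mxE eqxx addr0 -expr2 leNgt exprn_even_gt0 //=.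
  by rewrite lt_eqF.
exists p => //; split => //.
(* The variational inequality says that [p] maximizes the linear form of [y - p] over [K]. *)
rewrite dotpBl lerD2l lerN2; apply: dependency_hfun_le => // z Kz.
have := var z Kz; rewrite dotpC dotpBl.
by lra.
Qed.

Lemma pdist_le (a b : 'rV[R]_d) : K b -> pdist N a K <= N (a - b).
Proof.
move=> Kb; apply: ge_inf; last by exists b.
by exists 0 => _ [c _ <-]; exact: norm_fun_ge0.
Qed.

Lemma pdist_ge0 (a : 'rV[R]_d) : 0 <= pdist N a K.
Proof.
apply: lb_le_inf; last by move=> _ [c _ <-]; exact: norm_fun_ge0.
by have [b Kb] := dependency_nonempty; exists (N (a - b)); exists b.
Qed.

Lemma pdist_adherent (a : 'rV[R]_d) (e : R) : 0 < e ->
  exists2 b, K b & N (a - b) < pdist N a K + e.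
Proof.
move=> e0; have hi : has_inf [set N (a - b) | b in K].
  split; first by have [b Kb] := dependency_nonempty; exists (N (a - b)); exists b.
  by exists 0 => _ [c _ <-]; exact: norm_fun_ge0.
by have [_ [b Kb <-] h] := inf_adherent e0 hi; exists b.
Qed.

End DependencySet.

(** * Comparison of two dependency sets through their support functions *)

Section TwoSets.
Context {m1 m2 : spmeasure R d} {K1 K2 : set 'rV[R]_d}.
Context (nm1 : normalized N m1).
Context (nm2 : normalized N m2).
Context (dep1 : dependency_set_of N m1 K1).
Context (dep2 : dependency_set_of N m2 K2).

Lemma pdist_le_hfun (C eta : R) y : 0 < C -> (forall v, N v <= C * `|v|) ->
  0 <= eta ->
  (forall x, pbox 1 x -> hfun N m1 x - hfun N m2 x <= eta ^+ 2) ->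
  K1 y -> pdist N y K2 <= C * eta.
Proof.
move=> C0 HC eta0 H Ky; have [_ _ KO _ _] := dep1.
have [p Kp [xO hp]] := dependency_projection nm2 dep2 y (KO _ Ky).
have [_ _ KO2 _ _] := dep2.
(* Both sets lie in the unit cube and [y - p] is nonnegative, so the comparison of support functions
   is needed only on that cube. *)
have xb : pbox 1 (y - p).
  split => // i; rewrite !mxE; have /andP[_] := dependency_coord_le1 nm1 dep1 y i Ky.
  by have := KO2 _ Kp i; lra.
have := dependency_dotp_le nm1 dep1 y _ Ky xO => hy.
have hx : dotp (y - p) (y - p) <= eta ^+ 2 by have := H _ xb; lra.
apply: le_trans (pdist_le y p Kp) (le_trans (HC _) _).
apply: ler_wpM2l; first exact: ltW.
apply: norm_le_coord => // i.
rewrite ger0_norm // -(ler_pXn2r (n := 2)) ?nnegrE //.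
apply: le_trans hx; rewrite /dotp (bigD1 i) //= expr2 lerDl.
by apply: sumr_ge0 => j _; rewrite -expr2 sqr_ge0.
Qed.

(** Each [y] in [K1] has a nearly closest [b] in [K2], and [<y - b, x>] is at most [|y - b|] times
    the sum of the [|x_i|]. *)
Lemma hfun_le_pdist (c r : R) x : 0 < c -> (forall v, c * `|v| <= N v) ->
  orthant x -> (forall y, K1 y -> pdist N y K2 <= r) ->
  hfun N m1 x <= hfun N m2 x + (\sum_(i < d) `|x ord0 i|) / c * r.
Proof.
move=> c0 Hc x0 H; set X := \sum_(i < d) _.
have X0 : 0 <= X by exact: sumr_ge0.
apply: (dependency_hfun_le nm1 dep1) => // y Ky.
apply/ler_addgt0Pr => e e0.
have X1 : 0 < X / c + 1 by rewrite ltr_wpDl // divr_ge0 // ltW.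
(* The slack in the infimum is scaled so that, multiplied by [X / c], it costs at most [e]. *)
have e1 : 0 < e / (X / c + 1) by rewrite divr_gt0.
have [b Kb hb] := pdist_adherent nm2 dep2 y _ e1.
have h1 := dependency_dotp_le nm2 dep2 b x Kb x0.
have h2 : dotp y x - dotp b x <= `|y - b| * X by rewrite -dotpBl dotp_le_norm.
have h3 : `|y - b| <= (r + e / (X / c + 1)) / c.
  rewrite ler_pdivlMr // mulrC (le_trans (Hc _)) // (le_trans (ltW hb)) //.
  by rewrite lerD2r H.
have h4 : `|y - b| * X <= (r + e / (X / c + 1)) / c * X by rewrite ler_wpM2r.
have h5 : e / (X / c + 1) * (X / c) <= e.
  rewrite -mulrA ler_piMr ?(ltW e0) // mulrC ler_pdivrMr // mul1r lerDl.
  exact: ler01.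
have h6 : (r + e / (X / c + 1)) / c * X = X / c * r + e / (X / c + 1) * (X / c).
  have Xc : X + c != 0 by rewrite gt_eqF // ltr_wpDl.
  by field; rewrite Xc gt_eqF.
lra.
Qed.

(** Needed for the suprema in [hausdorff_dist] to be upper bounds; it holds as both sets lie in the
    unit cube. *)
Lemma pdist_bounded (C : R) : 0 < C -> (forall v, N v <= C * `|v|) ->
  has_ubound [set pdist N a K2 | a in K1].
Proof.
move=> C0 HC; have [b Kb] := dependency_nonempty nm2 dep2.
exists C => _ [a Ka <-].
apply: le_trans (pdist_le a b Kb) (le_trans (HC _) _).
rewrite -[leRHS]mulr1; apply: ler_wpM2l; first exact: ltW.
apply: norm_le_coord => // i.
rewrite !mxE; have /andP[] := dependency_coord_le1 nm1 dep1 a i Ka.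
have /andP[] := dependency_coord_le1 nm2 dep2 b i Kb.
by rewrite ler_norml => *; apply/andP; split; lra.
Qed.

End TwoSets.

Context {sigma : spmeasure R d} {sigman : nat -> spmeasure R d}.
Context {K : set 'rV[R]_d} {Kn : nat -> set 'rV[R]_d}.
Context (ns : normalized N sigma).
Context (nsn : forall n, normalized N (sigman n)).
Context (depK : dependency_set_of N sigma K).
Context (depKn : forall n, dependency_set_of N (sigman n) (Kn n)).

Lemma hausdorff_hfun_cvg : (fun n => hausdorff_dist N (Kn n) K) @ \oo --> 0 ->
  forall x : 'rV[R]_d, (forall i, 0 < x ord0 i) ->
    (fun n => hfun N (sigman n) x) @ \oo --> hfun N sigma x.
Proof.
move=> H x x0; have [C C0 HC] := norm_fun_upper normN.
have [c c0 Hc] := norm_fun_lower normN.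
have xO : orthant x by move=> i; exact: ltW.
pose X := \sum_(i < d) `|x ord0 i|.
have X0 : 0 <= X / c by rewrite divr_ge0 ?sumr_ge0 // ltW.
have key n : `|hfun N sigma x - hfun N (sigman n) x| <= X / c * hausdorff_dist N (Kn n) K.
  have r1 y : Kn n y -> pdist N y K <= hausdorff_dist N (Kn n) K.
    move=> Ky; rewrite /hausdorff_dist le_max; apply/orP; left.
    apply: ub_le_sup; last by exists y.
    exact: (pdist_bounded (nsn n) ns (depKn n) depK C).
  have r2 y : K y -> pdist N y (Kn n) <= hausdorff_dist N (Kn n) K.
    move=> Ky; rewrite /hausdorff_dist le_max; apply/orP; right.
    apply: ub_le_sup; last by exists y.
    exact: (pdist_bounded ns (nsn n) depK (depKn n) C).
  have h1 := hfun_le_pdist (nsn n) ns (depKn n) depK c _ x c0 Hc xO r1.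
  have h2 := hfun_le_pdist ns (nsn n) depK (depKn n) c _ x c0 Hc xO r2.
  by rewrite ler_norml; apply/andP; split; rewrite /X; lra.
have H0 : (fun n => X / c * hausdorff_dist N (Kn n) K) @ \oo --> 0.
  by rewrite -[0](mulr0 (X / c)); exact: cvgMr.
apply/cvgrPdist_le => e e0.
have /cvgrPdist_le/(_ _ e0) := H0; apply: filterS => n; rewrite sub0r normrN => hn.
exact: le_trans (key n) (le_trans (ler_norm _) hn).
Qed.

Lemma hfun_hausdorff_cvg :
  (forall x : 'rV[R]_d, (fun n => hfun N (sigman n) x) @ \oo --> hfun N sigma x) ->
  (fun n => hausdorff_dist N (Kn n) K) @ \oo --> 0.
Proof.
move=> H; have [C C0 HC] := norm_fun_upper normN.
apply/cvgrPdist_le => e e0.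
pose eta := e / C; have eta0 : 0 < eta by rewrite divr_gt0.
have eta2 : 0 < eta ^+ 2 by rewrite exprn_gt0.
(* Pointwise convergence becomes uniform on the cube by compactness: near [x] the common Lipschitz
   bound moves both functions by at most [eta^2 / 3]. *)
have unif : \forall n \near \oo, @pbox R d 1 `<=`
    [set x | `|hfun N sigma x - hfun N (sigman n) x| <= eta ^+ 2].
  have /compact_near_coveringP cB := @pbox_compact R d 1.
  apply: cB => x xB.
  have e3 : 0 < eta ^+ 2 / 3 by rewrite divr_gt0.
  have d1 : 0 < d%:R + 1 :> R by rewrite ltr_wpDl.
  have r0 : 0 < eta ^+ 2 / 3 / (d%:R + 1) by rewrite divr_gt0.
  have lip (m : spmeasure R d) x' : normalized N m ->
      `|x - x'| < eta ^+ 2 / 3 / (d%:R + 1) ->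
      `|hfun N m x - hfun N m x'| <= eta ^+ 2 / 3.
    move=> nm xx'; apply: le_trans (hfun_lip normN nm x x') _.
    apply: (@le_trans _ _ (\sum_(i < d) (eta ^+ 2 / 3 / (d%:R + 1)))).
      apply: ler_sum => i _; apply: le_trans (ltW xx').
      by have := coord_le_norm (x - x') i; rewrite !mxE.
    rewrite sumr_const card_ord -[_ *+ d]mulr_natr -mulrA.
    apply: ler_piMr; first exact: ltW.
    by rewrite mulrC ltW // ltr_pdivrMr // mul1r ltrDl.
  have /cvgrPdist_le/(_ _ e3) Hx := H x.
  near=> x' n.
  have xx' : `|x - x'| < eta ^+ 2 / 3 / (d%:R + 1).
    near: x'; apply/nbhs_ballP; exists (eta ^+ 2 / 3 / (d%:R + 1)) => // z.
    by rewrite mx_norm_ball.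
  have h1 := lip sigma x' ns xx'.
  have h2 := lip (sigman n) x' (nsn n) xx'.
  have h3 : `|hfun N sigma x - hfun N (sigman n) x| <= eta ^+ 2 / 3 by near: n.
  move: h1 h2 h3; rewrite /= !ler_norml => /andP[? ?] /andP[? ?] /andP[? ?].
  by apply/andP; split; lra.
apply: filterS unif => n hn.
have b1 y : Kn n y -> pdist N y K <= C * eta.
  apply: (pdist_le_hfun (nsn n) ns (depKn n) depK) => //; first exact: ltW.
  by move=> x xB; have := hn x xB; rewrite /= ler_norml => /andP[? ?]; lra.
have b2 y : K y -> pdist N y (Kn n) <= C * eta.
  apply: (pdist_le_hfun ns (nsn n) depK (depKn n)) => //; first exact: ltW.
  by move=> x xB; have := hn x xB; rewrite /= ler_norml => /andP[? ?]; lra.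
have Ce : C * eta = e by rewrite /eta mulrC divfK // gt_eqF.
rewrite Ce in b1 b2.
have [a Ka] := dependency_nonempty (nsn n) (depKn n).
have [b Kb] := dependency_nonempty ns depK.
rewrite sub0r normrN ger0_norm.
  rewrite /hausdorff_dist ge_max; apply/andP; split; apply: ge_sup.
  - by exists (pdist N a K); exists a.
  - by move=> _ [y Ky <-]; exact: b1.
  - by exists (pdist N b (Kn n)); exists b.
  - by move=> _ [y Ky <-]; exact: b2.
rewrite /hausdorff_dist le_max; apply/orP; left.
apply: le_trans (pdist_ge0 ns depK a) _; apply: ub_le_sup; last by exists a.
by exists e => _ [y Ky <-]; exact: b1.
Unshelve. all: by end_near. Qed.

End Hausdorff.

Theorem theorem4p3 (R : realType) (d : nat) (N : 'rV[R]_d -> R)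
    (mu : law R d) (mun : nat -> law R d)
    (sigma : spmeasure R d) (sigman : nat -> spmeasure R d)
    (K : set 'rV[R]_d) (Kn : nat -> set 'rV[R]_d) :
  is_norm N ->
  simple_max_stable mu -> (forall n, simple_max_stable (mun n)) ->
  spectral_measure_of N mu sigma ->
  (forall n, spectral_measure_of N (mun n) (sigman n)) ->
  dependency_set_of N sigma K ->
  (forall n, dependency_set_of N (sigman n) (Kn n)) ->
  (cvg_in_distribution mun mu <-> weak_cvg_on (Ssph N) sigman sigma) /\
  (weak_cvg_on (Ssph N) sigman sigma <->
     (fun n => hausdorff_dist N (Kn n) K) @ \oo --> 0).
Proof.
move=> normN smu smun spmu spmun depK depKn.
have ns := spectral_normalized _ _ spmu.
have nsn n := spectral_normalized _ _ (spmun n).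
(* (i) and (iii) supply convergence of [hfun] on the open orthant, which suffices for (ii); (ii)
   returns it at every point, including the boundary of the cube used for (iii). *)
split; split=> H.
- exact (hfun_weak_cvg normN ns nsn
    (cvg_in_distribution_hfun normN spmu spmun H)).
- exact (hfun_cvg_in_distribution normN smu smun spmu spmun
    (fun x _ => weak_cvg_hfun normN ns nsn H x)).
- exact (hfun_hausdorff_cvg normN ns nsn depK depKn
    (weak_cvg_hfun normN ns nsn H)).
- exact (hfun_weak_cvg normN ns nsn
    (hausdorff_hfun_cvg normN ns nsn depK depKn H)).
Qed.
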